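(* Let $R$ be a commutative noetherian ring, let $C$ be a semidualizing $R$-module, and let $M$ be an $R$-module with $\mathcal{P}_C\text{-}\operatorname{pd}_R(M)=0$ and $\mathcal{I}_C\text{-}\operatorname{id}_R(M)<\infty$. Then $R_{\mathfrak{p}}$ is Gorenstein for each $\mathfrak{p}\in\operatorname{Supp}_R(M)$.
   Context: Modules are not assumed finitely generated unless stated. A finitely generated $R$-module $C$ is semidualizing if the natural homothety map $R\to\operatorname{Hom}_R(C,C)$ is an isomorphism and $\operatorname{Ext}^{i}_R(C,C)=0$ for all $i\geq 1$. For a class $\mathcal{X}$ of $R$-modules, an $\mathcal{X}$-resolution of $M$ is a complex $X=\cdots\to X_1\to X_0\to 0$ of modules in $\mathcal{X}$ with $\operatorname{H}_0(X)\cong M$ and $\operatorname{H}_n(X)=0$ for $n\geq 1$; the $\mathcal{X}$-projective dimension $\mathcal{X}\text{-}\operatorname{pd}_R(M)$ is the infimum over all $\mathcal{X}$-resolutions $X$ of $M$ of $\sup\{n\geq 0\mid X_n\neq 0\}$. Dually, an $\mathcal{X}$-coresolution of $M$ is a complex $X=0\to X_0\to X_{-1}\to X_{-2}\to\cdots$ of modules in $\mathcal{X}$ with $\operatorname{H}_0(X)\cong M$ and $\operatorname{H}_n(X)=0$ for $n\leq -1$; the $\mathcal{X}$-injective dimension $\mathcal{X}\text{-}\operatorname{id}_R(M)$ is the infimum over all $\mathcal{X}$-coresolutions $X$ of $M$ of $\sup\{-n\geq 0\mid X_n\neq 0\}$. Conventions: each of these dimensions is $\infty$ if no such (co)resolution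 exists, and is $-\infty$ for $M=0$; the modules of $\mathcal{X}$-projective (respectively $\mathcal{X}$-injective) dimension $0$ are the nonzero modules of $\mathcal{X}$. $\mathcal{P}_C(R)$ is the class of modules isomorphic to $P\otimes_R C$ with $P$ a projective $R$-module, and $\mathcal{I}_C(R)$ is the class of modules isomorphic to $\operatorname{Hom}_R(C,I)$ with $I$ an injective $R$-module; $\mathcal{P}_C\text{-}\operatorname{pd}_R$ and $\mathcal{I}_C\text{-}\operatorname{id}_R$ are the associated dimensions. $\operatorname{Supp}_R(M)=\{\mathfrak{p}\in\operatorname{Spec}(R)\mid M_{\mathfrak{p}}\neq 0\}$. *)

(* Defs.v *)
From HB Require Import structures.
From mathcomp Require Import all_boot all_order all_algebra.
From mathcomp Require Import ring_quotient generic_quotient.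
From mathcomp Require Import boolp classical_sets constructive_ereal.
From mathcomp Require Import ring.

Set Implicit Arguments.
Unset Strict Implicit.
Unset Printing Implicit Defensive.

Import Order.TTheory GRing.Theory.
Local Open Scope classical_set_scope.
Local Open Scope quotient_scope.
Local Open Scope ring_scope.

Section Ideals.
Variable R : comPzRingType.

Definition is_ideal (I : set R) : Prop :=
  [/\ I 0, forall x y, I x -> I y -> I (x + y)
    & forall a x, I x -> I (a * x)].

Definition prime_ideal (p : set R) : Prop :=
  [/\ is_ideal p, ~ p 1 & forall x y, p (x * y) -> p x \/ p y].

Definition maximal_ideal (m : set R) : Prop :=
  [/\ is_ideal m, ~ m 1
    & forall I : set R, is_ideal I -> ~ I 1 -> m `<=` I -> I = m].

Definition is_local : Prop := exists! m : set R, maximal_ideal m.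

Definition noetherian : Prop := forall I : set R, is_ideal I ->
  exists n (g : 'I_n -> R),
    I = [set x | exists a : 'I_n -> R, x = \sum_i a i * g i].

Record Spec := MkSpec { spec_ideal : set R; specP : prime_ideal spec_ideal }.

End Ideals.
Arguments is_local : clear implicits.
Arguments noetherian : clear implicits.

Section Modules.
Variable R : comPzRingType.
Implicit Types U V W M : lmodType R.

Definition is_zero M : Prop := forall x : M, x = 0.

Definition isomorphic U V : Prop := exists f : {linear U -> V}, bijective f.

Definition fin_gen M : Prop := exists n (g : 'I_n -> M),
  forall x, exists a : 'I_n -> R, x = \sum_i a i *: g i.

Definition projective (P : lmodType R) : Prop :=
  forall U V (g : {linear U -> V}) (f : {linear P -> V}),
    (forall v, exists u, g u = v) ->
    exists h : {linear P -> U}, forall x, g (h x) = f x.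

Definition injective_module (I : lmodType R) : Prop :=
  forall U V (i : {linear U -> V}) (f : {linear U -> I}),
    injective i -> exists h : {linear V -> I}, forall x, h (i x) = f x.

End Modules.

(* The module structure of Hom_R(U, V), carried by {linear U -> V}. *)
Section Hom.
Variables (R : comPzRingType) (U V : lmodType R).
Implicit Types f g h : {linear U -> V}.

HB.instance Definition _ := gen_eqMixin {linear U -> V}.
HB.instance Definition _ := gen_choiceMixin {linear U -> V}.

Lemma linear_ext f g : f =1 g -> f = g.
Proof.
case: f g => f [[fa] [fs]] [g [[ga] [gs]]] /= /funext fg; subst g.
by congr (GRing.Linear.Pack (GRing.Linear.Class _ _));
  congr (_ _); apply: Prop_irrelevance.
Qed.

Definition hom_zero : {linear U -> V} := \0.
Definition hom_add f g : {linear U -> V} := f \+ g.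
Definition hom_opp f : {linear U -> V} := \- f.
Definition hom_scale (a : R) f : {linear U -> V} := a \*: f.

Fact hom_addA : associative hom_add.
Proof. by move=> f g h; apply: linear_ext => x /=; rewrite addrA. Qed.
Fact hom_addC : commutative hom_add.
Proof. by move=> f g; apply: linear_ext => x /=; rewrite addrC. Qed.
Fact hom_add0 : left_id hom_zero hom_add.
Proof. by move=> f; apply: linear_ext => x /=; rewrite add0r. Qed.
Fact hom_addN : left_inverse hom_zero hom_opp hom_add.
Proof. by move=> f; apply: linear_ext => x /=; rewrite addNr. Qed.

HB.instance Definition _ := GRing.isZmodule.Build {linear U -> V}
  hom_addA hom_addC hom_add0 hom_addN.

Fact hom_scaleA a b f : hom_scale a (hom_scale b f) = hom_scale (a * b) f.
Proof. by apply: linear_ext => x /=; rewrite scalerA. Qed.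
Fact hom_scale1 : left_id 1 hom_scale.
Proof. by move=> f; apply: linear_ext => x /=; rewrite scale1r. Qed.
Fact hom_scaleDr : right_distributive hom_scale +%R.
Proof. by move=> a f g; apply: linear_ext => x /=; rewrite scalerDr. Qed.
Fact hom_scaleDl f : {morph hom_scale^~ f : a b / a + b}.
Proof. by move=> a b; apply: linear_ext => x /=; rewrite scalerDl. Qed.

HB.instance Definition _ := GRing.Zmodule_isLmodule.Build R {linear U -> V}
  hom_scaleA hom_scale1 hom_scaleDr hom_scaleDl.

End Hom.

Section HomMap.
Variables (R : comPzRingType) (U U' V : lmodType R) (d : {linear U' -> U}).

Definition hom_map (f : {linear U -> V}) : {linear U' -> V} := f \o d.

Fact hom_map_is_linear : linear hom_map.
Proof. by move=> a f g; apply: linear_ext. Qed.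

HB.instance Definition _ := GRing.isLinear.Build R
  {linear U -> V} {linear U' -> V} *:%R hom_map hom_map_is_linear.

End HomMap.

(* Ker g / (Ker g `&` Im f), for U --f--> V --g--> W. *)
Section Homology.
Variables (R : comPzRingType) (U V W : lmodType R).
Variables (f : {linear U -> V}) (g : {linear V -> W}).

Definition is_cycle : {pred V} := fun x => g x == 0.

Fact is_cycle_closed : subsemimod_closed is_cycle.
Proof.
have cE x : (x \in is_cycle) = (g x == 0) by [].
split; first by split=> [|x y]; rewrite !cE ?linear0 // linearD;
  move=> /eqP-> /eqP->; rewrite addr0.
by move=> a x; rewrite !cE linearZ /= => /eqP->; rewrite scaler0.
Qed.

HB.instance Definition _ := GRing.isSubmodClosed.Build R V is_cycle
  is_cycle_closed.

Definition cycles : Type := {x : V | is_cycle x}.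
HB.instance Definition _ := SubChoice.on cycles.
HB.instance Definition _ := [SubChoice_isSubLmodule of cycles by <:].

Definition is_boundary : {pred cycles} := fun x => `[< exists u, f u = val x >].

Fact is_boundary_zmod_closed : zmod_closed is_boundary.
Proof.
split=> [|x y]; rewrite ?unfold_in.
  by apply/asboolP; exists 0; rewrite linear0.
move=> /asboolP[u eu] /asboolP[v ev]; apply/asboolP.
by exists (u - v); rewrite linearB eu ev.
Qed.

Fact is_boundary_scale a x : x \in is_boundary -> a *: x \in is_boundary.
Proof.
rewrite !unfold_in => /asboolP[u eu]; apply/asboolP.
by exists (a *: u); rewrite linearZ eu.
Qed.

HB.instance Definition _ := GRing.isZmodClosed.Build cycles is_boundary
  is_boundary_zmod_closed.

Definition homology : Type := Quotient.quot is_boundary.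
HB.instance Definition _ := GRing.Zmodule.on homology.

Definition homology_scale (a : R) (x : homology) : homology :=
  \pi_(Quotient.quot is_boundary) (a *: repr (x : Quotient.quot is_boundary)).

Fact homology_scale_pi a (x : cycles) :
  homology_scale a (\pi_(Quotient.quot is_boundary) x) =
  \pi_(Quotient.quot is_boundary) (a *: x).
Proof.
apply/eqP; rewrite -Quotient.idealrBE -scalerBr; apply: is_boundary_scale.
by rewrite Quotient.idealrBE reprK.
Qed.

Let homology_ind (P : homology -> Prop) :
  (forall x, P (\pi_(Quotient.quot is_boundary) x)) -> forall x, P x.
Proof. by move=> h x; rewrite -[x]reprK. Qed.

Fact homology_scaleA a b x :
  homology_scale a (homology_scale b x) = homology_scale (a * b) x.
Proof. by elim/homology_ind: x => x; rewrite !homology_scale_pi scalerA. Qed.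
Fact homology_scale1 : left_id 1 homology_scale.
Proof. by elim/homology_ind => x; rewrite homology_scale_pi scale1r. Qed.
Fact homology_scaleDr : right_distributive homology_scale +%R.
Proof.
move=> a; elim/homology_ind => x; elim/homology_ind => y.
rewrite !homology_scale_pi -!(raddfD \pi_(Quotient.quot is_boundary)).
by rewrite homology_scale_pi scalerDr.
Qed.
Fact homology_scaleDl x : {morph homology_scale^~ x : a b / a + b}.
Proof.
move=> a b; elim/homology_ind: x => x; rewrite !homology_scale_pi.
by rewrite -(raddfD \pi_(Quotient.quot is_boundary)) scalerDl.
Qed.

HB.instance Definition _ := GRing.Zmodule_isLmodule.Build R homology
  homology_scaleA homology_scale1 homology_scaleDr homology_scaleDl.

End Homology.

Section Complexes.
Variable R : comPzRingType.

Local Notation zero_mod := ('rV[R]_0 : lmodType R).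

Record chain_complex := ChainComplex {
  ch_obj :> nat -> lmodType R;
  ch_d : forall n, {linear ch_obj n.+1 -> ch_obj n};
  ch_dd : forall n x, ch_d n (ch_d n.+1 x) = 0 }.

(* co_obj n is the module in homological degree - n. *)
Record cochain_complex := CochainComplex {
  co_obj :> nat -> lmodType R;
  co_d : forall n, {linear co_obj n -> co_obj n.+1};
  co_dd : forall n x, co_d n.+1 (co_d n x) = 0 }.

Definition chain_homology (X : chain_complex) (n : nat) : lmodType R :=
  match n with
  | 0 => homology (ch_d X 0) (\0 : {linear X 0%N -> zero_mod})
  | m.+1 => homology (ch_d X m.+1) (ch_d X m)
  end.

Definition cochain_homology (X : cochain_complex) (n : nat) : lmodType R :=
  match n with
  | 0 => homology (\0 : {linear zero_mod -> X 0%N}) (co_d X 0)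
  | m.+1 => homology (co_d X m) (co_d X m.+1)
  end.

Definition is_resolution (cX : lmodType R -> Prop) (M : lmodType R)
    (X : chain_complex) : Prop :=
  [/\ forall n, cX (X n), isomorphic (chain_homology X 0) M
    & forall n, is_zero (chain_homology X n.+1)].

Definition is_coresolution (cX : lmodType R -> Prop) (M : lmodType R)
    (X : cochain_complex) : Prop :=
  [/\ forall n, cX (X n), isomorphic (cochain_homology X 0) M
    & forall n, is_zero (cochain_homology X n.+1)].

(* The supremum of the empty set is -oo, that of an unbounded set is +oo. *)
Definition cx_length (X : nat -> lmodType R) : \bar int :=
  supremum -oo%E [set n%:Z%:E | n in [set n | ~ is_zero (X n)]].

Definition proj_dim (cX : lmodType R -> Prop) (M : lmodType R) : \bar int :=
  if `[< is_zero M >] then -oo%E else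
  infimum +oo%E [set l | exists2 X, is_resolution cX M X & l = cx_length X].

Definition inj_dim (cX : lmodType R -> Prop) (M : lmodType R) : \bar int :=
  if `[< is_zero M >] then -oo%E else
  infimum +oo%E [set l | exists2 X, is_coresolution cX M X & l = cx_length X].

Section Ext.
Variables (P : chain_complex) (N : lmodType R).

Fact hom_complex_dd n (f : {linear P n -> N}) :
  hom_map (ch_d P n.+1) (hom_map (ch_d P n) f) = 0.
Proof. by apply: linear_ext => x /=; rewrite ch_dd linear0. Qed.

Definition hom_complex : cochain_complex :=
  CochainComplex (co_d := fun n => hom_map (ch_d P n)) hom_complex_dd.

End Ext.

(* Ext^i(M, N) = 0, with Ext^i(M, N) = H^i(Hom(P, N)) computed from a projective
   resolution P of M; up to isomorphism it does not depend on P. *)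
Definition Ext_vanishes (i : nat) (M N : lmodType R) : Prop :=
  forall P, is_resolution (@projective R) M P ->
    is_zero (cochain_homology (hom_complex P N) i).

Definition homothety (C : lmodType R) (a : R) : {linear C -> C} := a \*: idfun.

Definition semidualizing (C : lmodType R) : Prop :=
  [/\ fin_gen C, bijective (homothety C)
    & forall i, (1 <= i)%N -> Ext_vanishes i C C].

End Complexes.

(* P (x)_R C as the quotient of the finite formal sums of pairs (x, c), read as
   sums of x (x) c, by the identifications that every bilinear map makes; hence
   the universal property tensor_univ. *)
Section Tensor.
Variables (R : comPzRingType) (P C : lmodType R).

Definition bilinear_map (Z : lmodType R) (b : P -> C -> Z) : Prop :=
  (forall x, linear (b x)) /\ (forall c, linear (b^~ c)).

Definition sum_eval (Z : lmodType R) (b : P -> C -> Z) (s : seq (P * C)) : Z :=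
  \sum_(t <- s) b t.1 t.2.

Definition sum_eq (s t : seq (P * C)) : bool :=
  `[< forall (Z : lmodType R) (b : P -> C -> Z),
        bilinear_map b -> sum_eval b s = sum_eval b t >].

Fact sum_eq_refl : reflexive sum_eq.
Proof. by move=> s; apply/asboolP. Qed.
Fact sum_eq_sym : symmetric sum_eq.
Proof.
by move=> s t; apply/asboolP/asboolP => h Z b hb; rewrite (h Z b hb).
Qed.
Fact sum_eq_trans : transitive sum_eq.
Proof.
move=> t s u /asboolP h1 /asboolP h2; apply/asboolP => Z b hb.
by rewrite h1 // h2.
Qed.

Canonical sum_eq_equiv := EquivRel sum_eq sum_eq_refl sum_eq_sym sum_eq_trans.

Definition tensor : Type := {eq_quot sum_eq}.
HB.instance Definition _ := Choice.on tensor.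

Definition tensor_pi (s : seq (P * C)) : tensor := \pi_({eq_quot sum_eq}) s.
Definition tensor_repr (x : tensor) : seq (P * C) :=
  repr (x : {eq_quot sum_eq}).

Fact tensor_eqP s t : tensor_pi s = tensor_pi t <->
  forall (Z : lmodType R) (b : P -> C -> Z),
    bilinear_map b -> sum_eval b s = sum_eval b t.
Proof.
split=> [/eqP|h]; last by apply/eqP; rewrite eqmodE; apply/asboolP.
by rewrite eqmodE => /asboolP.
Qed.

Fact tensor_reprK x : tensor_pi (tensor_repr x) = x.
Proof. exact: reprK. Qed.

Fact sum_eval_repr (Z : lmodType R) (b : P -> C -> Z) s : bilinear_map b ->
  sum_eval b (tensor_repr (tensor_pi s)) = sum_eval b s.
Proof. by apply: (tensor_eqP _ _).1; rewrite tensor_reprK. Qed.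

Fact sum_eval_cat (Z : lmodType R) (b : P -> C -> Z) s t :
  sum_eval b (s ++ t) = sum_eval b s + sum_eval b t.
Proof. exact: big_cat. Qed.

Definition sum_scale (a : R) (s : seq (P * C)) :=
  [seq (a *: t.1, t.2) | t <- s].

Fact sum_eval_scale (Z : lmodType R) (b : P -> C -> Z) a s : bilinear_map b ->
  sum_eval b (sum_scale a s) = a *: sum_eval b s.
Proof.
move=> hb; rewrite /sum_eval big_map scaler_sumr; apply: eq_bigr => t _ /=.
exact: (scalable_linear (hb.2 t.2)).
Qed.

Definition tensor_zero : tensor := tensor_pi [::].
Definition tensor_add (x y : tensor) : tensor :=
  tensor_pi (tensor_repr x ++ tensor_repr y).
Definition tensor_scale (a : R) (x : tensor) : tensor :=
  tensor_pi (sum_scale a (tensor_repr x)).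
Definition tensor_opp : tensor -> tensor := tensor_scale (- 1).

Local Ltac tensor_tac :=
  apply/tensor_eqP => ? ? ?;
  rewrite ?(sum_eval_cat, sum_eval_scale, sum_eval_repr) //.

Fact tensor_addA : associative tensor_add.
Proof. by move=> x y z; tensor_tac; rewrite addrA. Qed.
Fact tensor_addC : commutative tensor_add.
Proof. by move=> x y; tensor_tac; rewrite addrC. Qed.
Fact tensor_add0 : left_id tensor_zero tensor_add.
Proof.
move=> x; rewrite -[RHS]tensor_reprK; tensor_tac.
by rewrite /sum_eval big_nil add0r.
Qed.
Fact tensor_addN : left_inverse tensor_zero tensor_opp tensor_add.
Proof. by move=> x; tensor_tac; rewrite scaleN1r addNr /sum_eval big_nil. Qed.

HB.instance Definition _ := GRing.isZmodule.Build tensor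
  tensor_addA tensor_addC tensor_add0 tensor_addN.

Fact tensor_scaleA a b x :
  tensor_scale a (tensor_scale b x) = tensor_scale (a * b) x.
Proof. by tensor_tac; rewrite scalerA. Qed.
Fact tensor_scale1 : left_id 1 tensor_scale.
Proof.
by move=> x; rewrite -[RHS]tensor_reprK; tensor_tac; rewrite scale1r.
Qed.
Fact tensor_scaleDr : right_distributive tensor_scale +%R.
Proof. by move=> a x y; tensor_tac; rewrite scalerDr. Qed.
Fact tensor_scaleDl x : {morph tensor_scale^~ x : a b / a + b}.
Proof. by move=> a b; tensor_tac; rewrite scalerDl. Qed.

HB.instance Definition _ := GRing.Zmodule_isLmodule.Build R tensor
  tensor_scaleA tensor_scale1 tensor_scaleDr tensor_scaleDl.

Definition pure_tensor (x : P) (c : C) : tensor := tensor_pi [:: (x, c)].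

Lemma pure_tensor_bilinear : bilinear_map pure_tensor.
Proof.
split=> [x a c d|c a x y]; apply/tensor_eqP => Z b hb;
  rewrite ?(sum_eval_cat, sum_eval_scale, sum_eval_repr) //.
  by rewrite /sum_eval !big_seq1 (hb.1 x).
by rewrite /sum_eval !big_seq1 (hb.2 c).
Qed.

Lemma tensor_univ (Z : lmodType R) (b : P -> C -> Z) : bilinear_map b ->
  exists! h : {linear tensor -> Z}, forall x c, h (pure_tensor x c) = b x c.
Proof.
move=> hb; pose h (x : tensor) : Z := sum_eval b (tensor_repr x).
have h_lin : linear h.
  by move=> a x y; rewrite /h ?(sum_eval_repr, sum_eval_cat, sum_eval_scale).
pose hL := GRing.isLinear.Build R tensor Z *:%R h h_lin.
exists (HB.pack h hL : {linear tensor -> Z}); split=> /= [x c|k hk].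
  by rewrite /h sum_eval_repr // /sum_eval big_seq1.
apply: linear_ext => x /=; rewrite -[x in RHS]tensor_reprK /h.
elim: (tensor_repr x) => [|[y c] s IHs].
  by rewrite /sum_eval big_nil (_ : tensor_pi _ = 0) ?linear0.
have -> : tensor_pi ((y, c) :: s) = pure_tensor y c + tensor_pi s.
  by tensor_tac; rewrite /sum_eval big_cons big_seq1.
by rewrite linearD hk -IHs /sum_eval big_cons.
Qed.

End Tensor.

Section FoxbyClasses.
Variables (R : comPzRingType) (C : lmodType R).

Definition class_PC (M : lmodType R) : Prop :=
  exists2 P : lmodType R, projective P & isomorphic M (tensor P C).

Definition class_IC (M : lmodType R) : Prop :=
  exists2 I : lmodType R, injective_module I & isomorphic M {linear C -> I}.

Definition PC_pd (M : lmodType R) : \bar int := proj_dim class_PC M.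
Definition IC_id (M : lmodType R) : \bar int := inj_dim class_IC M.

End FoxbyClasses.

Section Localization.
Variables (R : comPzRingType) (p : Spec R).

Record denom := Denom { den_val : R; denP : `[< ~ spec_ideal p den_val >] }.
HB.instance Definition _ := [isSub for den_val].
HB.instance Definition _ := [Choice of denom by <:].

Fact denom1_subproof : `[< ~ spec_ideal p 1 >].
Proof. by apply/asboolP; case: (specP p). Qed.
Definition denom1 : denom := Denom denom1_subproof.

Fact denomM_subproof (s t : denom) :
  `[< ~ spec_ideal p (den_val s * den_val t) >].
Proof.
apply/asboolP; case: (specP p) => _ _ pP.
by move=> /pP[]; apply/asboolP; apply: denP.
Qed.
Definition denomM (s t : denom) : denom := Denom (denomM_subproof s t).

Section Module.
Variable M : lmodType R.

Definition frac_eq (x y : M * denom) : bool :=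
  `[< exists u : denom,
        (den_val u * den_val y.2) *: x.1 = (den_val u * den_val x.2) *: y.1 >].

Fact frac_eq_refl : reflexive frac_eq.
Proof. by move=> x; apply/asboolP; exists denom1. Qed.
Fact frac_eq_sym : symmetric frac_eq.
Proof. by move=> x y; apply/asboolP/asboolP => -[u eu]; exists u. Qed.
Fact frac_eq_trans : transitive frac_eq.
Proof.
move=> y x z /asboolP[u eu] /asboolP[v ev]; apply/asboolP.
exists (denomM (denomM u v) y.2) => /=.
have -> : den_val u * den_val v * den_val y.2 * den_val z.2 =
  (den_val v * den_val z.2) * (den_val u * den_val y.2) by ring.
have -> : den_val u * den_val v * den_val y.2 * den_val x.2 =
  (den_val u * den_val x.2) * (den_val v * den_val y.2) by ring.
by rewrite -scalerA eu scalerA mulrC -[LHS]scalerA ev scalerA.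
Qed.

Canonical frac_equiv := EquivRel frac_eq frac_eq_refl frac_eq_sym frac_eq_trans.

Definition localization : Type := {eq_quot frac_eq}.
HB.instance Definition _ := Choice.on localization.

(* The fraction m / s. *)
Definition mk_frac (m : M) (s : denom) : localization :=
  \pi_({eq_quot frac_eq}) (m, s).

Fact mk_fracP m s n t : mk_frac m s = mk_frac n t <->
  exists u : denom, (den_val u * den_val t) *: m = (den_val u * den_val s) *: n.
Proof.
split=> [/eqP|h]; last by apply/eqP; rewrite eqmodE; apply/asboolP.
by rewrite eqmodE => /asboolP.
Qed.

Definition numer (x : localization) : M := (repr (x : {eq_quot frac_eq})).1.
Definition denominator (x : localization) : denom :=
  (repr (x : {eq_quot frac_eq})).2.

Fact mk_fracK x : mk_frac (numer x) (denominator x) = x.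
Proof. by rewrite /mk_frac -surjective_pairing reprK. Qed.

Fact loc_ind (Q : localization -> Prop) :
  (forall m s, Q (mk_frac m s)) -> forall x, Q x.
Proof. by move=> h x; rewrite -[x]mk_fracK. Qed.

Definition loc_zero : localization := mk_frac 0 denom1.
Definition loc_opp (x : localization) := mk_frac (- numer x) (denominator x).
Definition loc_add (x y : localization) := mk_frac
  (den_val (denominator y) *: numer x + den_val (denominator x) *: numer y)
  (denomM (denominator x) (denominator y)).

Fact loc_oppE m s : loc_opp (mk_frac m s) = mk_frac (- m) s.
Proof.
have [u eu] := (mk_fracP _ _ _ _).1 (mk_fracK (mk_frac m s)).
by apply/mk_fracP; exists u; rewrite !scalerN eu.
Qed.

Fact loc_addE m s n t : loc_add (mk_frac m s) (mk_frac n t) =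
  mk_frac (den_val t *: m + den_val s *: n) (denomM s t).
Proof.
have [u eu] := (mk_fracP _ _ _ _).1 (mk_fracK (mk_frac m s)).
have [v ev] := (mk_fracP _ _ _ _).1 (mk_fracK (mk_frac n t)).
rewrite /loc_add; set m' := numer _ in eu *; set s' := denominator _ in eu *.
set n' := numer _ in ev *; set t' := denominator _ in ev *.
apply/mk_fracP; exists (denomM u v); rewrite /= !scalerDr !scalerA.
congr (_ + _).
  have -> : den_val u * den_val v * (den_val s * den_val t) * den_val t' =
    (den_val v * den_val t * den_val t') * (den_val u * den_val s) by ring.
  by rewrite -scalerA eu scalerA; congr (_ *: _); ring.
have -> : den_val u * den_val v * (den_val s * den_val t) * den_val s' =
  (den_val u * den_val s * den_val s') * (den_val v * den_val t) by ring.
by rewrite -scalerA ev scalerA; congr (_ *: _); ring.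
Qed.

Fact mk_frac_eq m s n t : den_val t *: m = den_val s *: n ->
  mk_frac m s = mk_frac n t.
Proof. by move=> e; apply/mk_fracP; exists denom1; rewrite !mul1r. Qed.

Fact loc_addA : associative loc_add.
Proof.
elim/loc_ind => m s; elim/loc_ind => n t; elim/loc_ind => k u.
rewrite !loc_addE; apply: mk_frac_eq => /=; rewrite !scalerDr !scalerA addrA.
by congr (_ *: _ + _ *: _ + _ *: _); ring.
Qed.
Fact loc_addC : commutative loc_add.
Proof.
elim/loc_ind => m s; elim/loc_ind => n t; rewrite !loc_addE.
by apply: mk_frac_eq => /=; rewrite addrC mulrC.
Qed.
Fact loc_add0 : left_id loc_zero loc_add.
Proof.
elim/loc_ind => m s; rewrite loc_addE; apply: mk_frac_eq => /=.
by rewrite scaler0 add0r scale1r mul1r.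
Qed.
Fact loc_addN : left_inverse loc_zero loc_opp loc_add.
Proof.
elim/loc_ind => m s; rewrite loc_oppE loc_addE; apply: mk_frac_eq => /=.
by rewrite scalerN addNr !scaler0.
Qed.

HB.instance Definition _ := GRing.isZmodule.Build localization
  loc_addA loc_addC loc_add0 loc_addN.

End Module.

(* R_p is the localization of the R-module R, and (a / s) *: (m / t) is
   (a *: m) / (s * t) on M_p; the product of R_p is the case M = R. *)
Definition local_ring : Type := localization (R^o : lmodType R).
HB.instance Definition _ := GRing.Zmodule.on local_ring.

Definition loc_scale (M : lmodType R) (a : local_ring) (x : localization M) :=
  mk_frac ((numer a : R) *: numer x) (denomM (denominator a) (denominator x)).

Fact loc_scaleE (M : lmodType R) (a : R) s (m : M) t :
  loc_scale (mk_frac (a : R^o) s) (mk_frac m t) = mk_frac (a *: m) (denomM s t).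
Proof.
have [u] := (mk_fracP _ _ _ _).1 (mk_fracK (mk_frac (a : R^o) s)).
have [v] := (mk_fracP _ _ _ _).1 (mk_fracK (mk_frac m t)).
rewrite /loc_scale; move: (numer (mk_frac m t)) (denominator (mk_frac m t)).
move: (numer (mk_frac (a : R^o) s)) (denominator (mk_frac (a : R^o) s)).
move=> a' s' m' t' ev eu.
have {}eu : (den_val u * den_val s) * (a' : R) =
  (den_val u * den_val s') * a := eu.
apply/mk_fracP; exists (denomM u v); rewrite /= !scalerA.
have -> : den_val u * den_val v * (den_val s * den_val t) * (a' : R) =
  (den_val u * den_val s * (a' : R)) * (den_val v * den_val t) by ring.
by rewrite -scalerA ev scalerA eu; congr (_ *: _); ring.
Qed.

Definition loc_one : local_ring := mk_frac (1 : R^o) denom1.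

Fact loc_mulE (a : R) s (b : R) t :
  loc_scale (mk_frac (a : R^o) s) (mk_frac (b : R^o) t) =
  mk_frac (a * b : R^o) (denomM s t).
Proof. exact: loc_scaleE. Qed.

Section Scale.
Variable M : lmodType R.
Implicit Types (a b : local_ring) (x y : localization M).

Fact loc_scaleA a b x :
  loc_scale a (loc_scale b x) = loc_scale (loc_scale (M := R^o) a b) x.
Proof.
elim/loc_ind: a => a s; elim/loc_ind: b => b t; elim/loc_ind: x => m u.
rewrite (loc_mulE a s b t) (loc_scaleE b t m u) !loc_scaleE.
by apply: mk_frac_eq; rewrite /= !scalerA; congr (_ *: _); ring.
Qed.
Fact loc_scale1 x : loc_scale loc_one x = x.
Proof.
elim/loc_ind: x => m s; rewrite loc_scaleE; apply: mk_frac_eq => /=.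
by rewrite scale1r mul1r.
Qed.
Fact loc_scaleDr a x y : loc_scale a (x + y) = loc_scale a x + loc_scale a y.
Proof.
elim/loc_ind: a => a s; elim/loc_ind: x => m t; elim/loc_ind: y => n u.
rewrite [_ + _]loc_addE !loc_scaleE [RHS]loc_addE; apply: mk_frac_eq => /=.
by rewrite !scalerDr !scalerA; congr (_ *: _ + _ *: _); ring.
Qed.
Let reg_scaleE (c d : R) : c *: (d : R^o) = c * d. Proof. by []. Qed.

Fact loc_scaleDl a b x : loc_scale (a + b) x = loc_scale a x + loc_scale b x.
Proof.
elim/loc_ind: a => a s; elim/loc_ind: b => b t; elim/loc_ind: x => m u.
rewrite [X in loc_scale X]loc_addE !loc_scaleE [RHS]loc_addE.
apply: mk_frac_eq => /=; rewrite scalerDl !scalerDr !scalerA.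
by rewrite !reg_scaleE; congr (_ *: _ + _ *: _); ring.
Qed.

End Scale.

Fact loc_mulC : commutative (loc_scale (M := R^o)).
Proof.
elim/loc_ind => a s; elim/loc_ind => b t; rewrite !loc_mulE.
by congr (mk_frac _ _); [rewrite mulrC | apply: val_inj; rewrite /= mulrC].
Qed.
Fact loc_mulA : associative (loc_scale (M := R^o)).
Proof. by move=> a b c; rewrite loc_scaleA. Qed.

HB.instance Definition _ := GRing.Zmodule_isComPzRing.Build local_ring
  loc_mulA loc_mulC (@loc_scale1 R^o) (fun a b => @loc_scaleDl R^o a b).

HB.instance Definition _ (M : lmodType R) :=
  GRing.Zmodule_isLmodule.Build local_ring (localization M)
    (@loc_scaleA M) (@loc_scale1 M) (@loc_scaleDr M)
    (fun x a b => @loc_scaleDl M a b x).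

End Localization.

Definition Supp (R : comPzRingType) (M : lmodType R) : set (Spec R) :=
  [set p | ~ is_zero (localization p M : lmodType (local_ring p))].

(* A noetherian local ring is Gorenstein if its self-injective dimension is
   finite. *)
Definition gorenstein_local (A : comPzRingType) : Prop :=
  [/\ noetherian A, is_local A
    & (inj_dim (@injective_module A) (A^o : lmodType A) < +oo)%E].

(* Main.v *)
From HB Require Import structures.
Require Import Defs.
From mathcomp Require Import all_boot all_order all_algebra.
From mathcomp Require Import boolp classical_sets functions constructive_ereal.
From mathcomp Require Import ring_quotient generic_quotient.
From mathcomp Require Import ring zify.

(** Write M = P (x) C with P projective. The proof shows that C_p is isomorphic
    to R_p for every prime p in the support of M; then Hom(C, I)_p is I_p for
    every I, which is injective over R_p when I is injective over R, so that
    the given coresolution of M localizes to a finite injective coresolution of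
    M_p. As R_p is a direct summand of M_p, its own injective dimension is
    finite.

    The isomorphism between C_p and R_p comes from the swap of C (x) C. Let F
    be a resolution of C by finitely generated free modules. For I injective,
    applying Hom(_, I) to the exact complex R -> Hom(F, C), whose exactness is
    the definition of a semidualizing module, shows that C (x) Hom(C, I) -> I
    is injective and that Tor_i(C, Hom(C, I)) = 0 for i > 0 ([evaluation_inj],
    [tor_vanishes_hom]). The vanishing of Tor passes to M and its cosyzygies,
    by induction along the finite coresolution ([tor_vanishes_coresolution]).
    This is where its finiteness is used. Hence C (x) M embeds in I, where M
    embeds in Hom(C, I) ([tensor_embedding]), and the natural map from M to
    Hom(C, C (x) M) is onto ([hom_into_image]).

    If p is in the support of M, some linear form f on P takes a value s = f y
    outside p ([projective_support]), so that C -> M -> C, the maps induced by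
    y and f, compose to the multiplication by s. By the above, the
    endomorphisms of C (x) C are homotheties up to s, in particular the swap:
    there is u with s (c (x) c') = u (c' (x) c) for all c and c'
    ([tensor_swap]). Over the residue field of p, such a relation forces the
    dimension of C to be at most one ([swap_locally_cyclic]), and a cyclic
    module with injective homothety map is free ([locally_cyclic_unit]).

    Injectivity of I_p is checked by Baer's criterion ([baer_injective],
    [loc_injective]), and the injective dimension of a retract is bounded by a
    direct construction ([inj_dim_le_retract]). Modules tensored with F are
    handled as tuples of elements on which the matrices of F act. *)

Set Implicit Arguments.
Unset Strict Implicit.
Unset Printing Implicit Defensive.

Import Order.TTheory GRing.Theory Num.Theory.
Local Open Scope classical_set_scope.
Local Open Scope quotient_scope.
Local Open Scope ring_scope.

(** * Linear maps, submodules and quotients *)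

Section LinearMaps.
Variable R : comPzRingType.
Implicit Types U V W : lmodType R.

Definition mk_linear U V (f : U -> V) (f_lin : linear f) : {linear U -> V} :=
  HB.pack f (GRing.isLinear.Build R U V *:%R f f_lin).

Lemma mk_linearE U V (f : U -> V) (f_lin : linear f) : mk_linear f_lin =1 f.
Proof. by []. Qed.

Lemma linear_inj0 U V (f : {linear U -> V}) :
  (forall x, f x = 0 -> x = 0) -> injective f.
Proof.
move=> f0 x y exy; apply/eqP; rewrite -subr_eq0; apply/eqP/f0.
by rewrite linearB exy subrr.
Qed.

Lemma factor_surj U V W (q : {linear U -> V}) (f : {linear U -> W}) :
  (forall v, exists u, q u = v) -> (forall u, q u = 0 -> f u = 0) ->
  exists h : {linear V -> W}, forall u, h (q u) = f u.
Proof.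
move=> /choice[s sP] q0.
have hP u : f (s (q u)) = f u.
  by apply/eqP; rewrite -subr_eq0 -linearB q0 // linearB sP subrr.
have h_lin : linear (f \o s).
  move=> a x y /=; rewrite -linearP -[RHS]hP.
  by congr (f (s _)); rewrite linearP !sP.
by exists (mk_linear h_lin).
Qed.

Lemma factor_inj U V W (i : {linear W -> V}) (f : {linear U -> V}) :
  injective i -> (forall u, exists w, i w = f u) ->
  exists h : {linear U -> W}, forall u, i (h u) = f u.
Proof.
move=> i_inj /choice[s sP].
have s_lin : linear s by move=> a x y; apply: i_inj; rewrite !(sP, linearP).
by exists (mk_linear s_lin).
Qed.

Lemma bijective_linearV U V (f : {linear U -> V}) : bijective f ->
  exists2 g : {linear V -> U}, cancel f g & cancel g f.
Proof.
move=> [g fK gK].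
have g_lin : linear g by move=> a x y; apply: (can_inj fK); rewrite linearP !gK.
by exists (mk_linear g_lin).
Qed.

Lemma isomorphic_sym U V : isomorphic U V -> isomorphic V U.
Proof.
by move=> [f /bijective_linearV[g fK gK]]; exists g; exists f.
Qed.

Lemma isomorphic_trans V U W :
  isomorphic U V -> isomorphic V W -> isomorphic U W.
Proof.
by move=> [f fb] [g gb]; exists (g \o f : {linear U -> W}); apply: bij_comp.
Qed.

End LinearMaps.

Section Submodule.
Variables (R : comPzRingType) (V : lmodType R) (S : V -> Prop).
Hypotheses (S0 : S 0) (SP : forall a x y, S x -> S y -> S (a *: x + y)).

(** The submodule of [V] of the elements that satisfy [S]. *)
Definition submod_pred : {pred V} := fun x => `[< S x >].

Fact submod_pred_closed : subsemimod_closed submod_pred.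
Proof.
have cE x : (x \in submod_pred) = `[< S x >] by [].
split; first (split=> [|x y]; rewrite !cE).
- exact/asboolP.
- by move=> /asboolP Sx /asboolP Sy; apply/asboolP; rewrite -[x]scale1r;
    apply: SP.
by move=> a x; rewrite !cE => /asboolP Sx; apply/asboolP;
  rewrite -[_ *: _]addr0; apply: SP.
Qed.

HB.instance Definition _ := GRing.isSubmodClosed.Build R V submod_pred
  submod_pred_closed.

Definition submod : Type := {x : V | submod_pred x}.
HB.instance Definition _ := SubChoice.on submod.
HB.instance Definition _ := [SubChoice_isSubLmodule of submod by <:].

Lemma exists_submodule : exists (W : lmodType R) (i : {linear W -> V}),
  injective i /\ forall v, S v <-> exists w, i w = v.
Proof.
exists (submod : lmodType R), (\val : {linear submod -> V}); split;
  first exact: val_inj.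
move=> v; split=> [Sv|[w <-]]; last exact: (asboolW (valP w)).
by exists (exist _ v (asboolT Sv)).
Qed.

End Submodule.

Section Quotients.
Variable R : comPzRingType.
Implicit Types U V W : lmodType R.

Lemma exists_image U V (f : {linear U -> V}) :
  exists (W : lmodType R) (q : {linear U -> W}) (i : {linear W -> V}),
    [/\ injective i, forall w, exists u, q u = w & forall u, i (q u) = f u].
Proof.
have [||W [i [i_inj iP]]] := @exists_submodule R V (fun v => exists u, f u = v).
- by exists 0; rewrite linear0.
- by move=> a x y [u <-] [v <-]; exists (a *: u + v); rewrite linearP.
have [u|q qP] := factor_inj (f := f) i_inj; first by apply/iP; exists u.
exists W, q, i; split=> // w;
  have /iP[u eu] : exists w', i w' = i w by exists w.
by exists u; apply: i_inj; rewrite qP.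
Qed.

Lemma homology_piP U V W (f : {linear U -> V}) (g : {linear V -> W}) :
  exists2 q : {linear cycles g -> homology f g},
    forall h, exists z, q z = h & forall z, q z = 0 <-> exists u, f u = val z.
Proof.
have q_lin : linear (\pi_(Quotient.quot (@is_boundary R U V W f g)) :
    cycles g -> homology f g).
  by move=> a x y; rewrite raddfD /= -homology_scale_pi.
exists (mk_linear q_lin) => [h|z];
  first by exists (repr (h : Quotient.quot _)); rewrite mk_linearE reprK.
have <- : z \in @is_boundary R U V W f g <-> exists u, f u = val z.
  by split=> [/asboolP//|?]; apply/asboolP.
rewrite -[z in z \in _]subr0 Quotient.idealrBE raddf0 mk_linearE.
by split=> [->//|/eqP].
Qed.

(** The cokernel of [f] is obtained as the homology of [U --f--> V --0--> V]. *)
Lemma exists_cokernel U V (f : {linear U -> V}) :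
  exists (Q : lmodType R) (q : {linear V -> Q}),
    (forall x, exists v, q v = x) /\ forall v, q v = 0 <-> exists u, f u = v.
Proof.
have [q q_surj qP] := homology_piP f (\0 : {linear V -> V}).
have z_in (v : V) : is_cycle (\0 : {linear V -> V}) v by exact: eqxx.
pose c (v : V) : cycles (\0 : {linear V -> V}) := Sub v (z_in v).
have c_lin : linear (q \o c).
  move=> a x y /=; rewrite -linearP; congr (q _); apply: val_inj.
  by rewrite linearP !SubK.
exists (homology f (\0 : {linear V -> V}) : lmodType R), (mk_linear c_lin);
  split=> [x|v].
  by have [z <-] := q_surj x; exists (val z); rewrite mk_linearE /=;
    congr (q _); apply: val_inj.
by rewrite mk_linearE /= qP SubK.
Qed.

End Quotients.

(** * Injective modules and injective dimension *)

Section InjectiveModules.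
Variable R : comPzRingType.
Implicit Types U V W M N I E : lmodType R.

Definition short_exact U V W (i : {linear U -> V}) (q : {linear V -> W}) :
    Prop :=
  [/\ injective i, forall w, exists v, q v = w
    & forall v, q v = 0 <-> exists u, i u = v].

(** [M] has a coresolution by modules of [cX] that vanishes from degree [n] on,
    presented as an iterated choice of embeddings in modules of [cX] whose last
    cokernel is zero. *)
Fixpoint finite_coresolution (cX : lmodType R -> Prop) (n : nat)
    (M : lmodType R) : Prop :=
  if n is k.+1 then
    exists (X Q : lmodType R) (i : {linear M -> X}) (q : {linear X -> Q}),
      [/\ cX X, short_exact i q & finite_coresolution cX k Q]
  else is_zero M.

(** [M] has injective dimension at most [n]: after [n] embeddings in injective
    modules, the cokernel is injective. *)
Fixpoint inj_dim_le (n : nat) (M : lmodType R) : Prop :=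
  if n is k.+1 then
    exists (X Q : lmodType R) (i : {linear M -> X}) (q : {linear X -> Q}),
      [/\ injective_module X, short_exact i q & inj_dim_le k Q]
  else injective_module M.

Lemma injective_factor I U V (b : {linear U -> V}) (f : {linear U -> I}) :
  injective_module I -> (forall x, b x = 0 -> f x = 0) ->
  exists h : {linear V -> I}, forall x, h (b x) = f x.
Proof.
move=> I_inj bf; have [W [q [i [i_inj q_surj iq]]]] := exists_image b.
have [|g gP] := factor_surj (f := f) q_surj.
  by move=> u qu; apply: bf; rewrite -iq qu linear0.
have [h hP] := I_inj _ _ i g i_inj.
by exists h => x; rewrite -iq hP gP.
Qed.

Lemma injective_retract I E (i : {linear E -> I}) (r : {linear I -> E}) :
  cancel i r -> injective_module I -> injective_module E.
Proof.
move=> irK I_inj U V j f j_inj.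
have [h hP] := I_inj _ _ j (i \o f : {linear U -> I}) j_inj.
by exists (r \o h : {linear V -> E}) => x; rewrite /= hP /= irK.
Qed.

Lemma injective_zero E : is_zero E -> injective_module E.
Proof.
by move=> E0 U V j f _; exists (\0 : {linear V -> E}) => x; rewrite [RHS]E0.
Qed.

Lemma injective_prod I E : injective_module I -> injective_module E ->
  injective_module (I * E)%type.
Proof.
move=> I_inj E_inj U V j f j_inj.
have [h hP] := I_inj _ _ j (fst \o f : {linear U -> I}) j_inj.
have [k kP] := E_inj _ _ j (snd \o f : {linear U -> E}) j_inj.
have hk_lin : linear (fun x => (h x, k x)).
  by move=> a x y; rewrite !linearP.
exists (mk_linear hk_lin) => x; rewrite mk_linearE hP kP /=.
by case: (f x).
Qed.

Lemma inj_dim_le_prod n N E : injective_module E -> inj_dim_le n N ->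
  inj_dim_le n (N * E)%type.
Proof.
move=> E_inj; case: n => [|n] /=; first by move=> N_inj; apply: injective_prod.
move=> [X [Q [i [q [X_inj [i_inj q_surj qP] Qn]]]]].
have iE_lin : linear (fun x : N * E => (i x.1, x.2)).
  by move=> a x y; rewrite linearP.
have qE_lin : linear (fun x : X * E => q x.1) by move=> a x y; rewrite linearP.
exists (X * E)%type, Q, (mk_linear iE_lin), (mk_linear qE_lin).
split=> //; first exact: injective_prod.
split=> [[x e] [y f] /= []|y|[x e]] /=; first by move=> /i_inj -> ->.
  by have [x ex] := q_surj y; exists (x, 0).
rewrite qP; split=> [[u <-]|[[u e'] [<- _]]]; last by exists u.
by exists (u, e).
Qed.

(** Let [N] embed in an injective module [X]. If [k : X -> X] extends the
    idempotent [i \o r] of [N], then [x |-> (x, (1 - k) x)] and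
    [(x, y) |-> k x + y] exhibit [X / A] as a retract of [X / N * X]. *)
Lemma inj_dim_le_retract n (A N : lmodType R)
    (i : {linear A -> N}) (r : {linear N -> A}) :
  cancel i r -> inj_dim_le n N -> inj_dim_le n A.
Proof.
elim: n A N i r => [|n IHn] A N i r irK /=; first exact: injective_retract irK.
move=> [X [Q [j [q [X_inj [j_inj q_surj qP] Qn]]]]].
pose ji : {linear A -> X} := j \o i.
have [P [p [p_surj pP]]] := exists_cokernel ji.
have [k kP] := X_inj _ _ j (ji \o r : {linear N -> X}) j_inj.
have kji a : k (ji a) = ji a by rewrite kP /= irK.
have [u uP] : exists u : {linear P -> X}, forall x, u (p x) = x - k x.
  have l : linear (fun x : X => x - k x).
    by move=> a x y; rewrite linearP scalerBr opprD addrACA.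
  by apply: (factor_surj (f := mk_linear l) p_surj) => x /pP[a <-] /=;
    rewrite kji subrr.
have [s sP] : exists s : {linear P -> Q}, forall x, s (p x) = q x.
  by apply: factor_surj => // x /pP[a <-]; apply/qP; exists (i a).
have [t tP] : exists t : {linear Q -> P}, forall x, t (q x) = p (k x).
  apply: (factor_surj (f := p \o k : {linear X -> P}) q_surj) => x /qP[a <-] /=.
  by rewrite kP; apply/pP; exists (r a).
have su_lin : linear (fun x => (s x, u x)) by move=> a x y; rewrite !linearP.
have tp_lin : linear (fun x : Q * X => t x.1 + p x.2).
  by move=> a x y; rewrite !linearP scalerDr addrACA.
exists X, P, ji, p; split=> //.
  by split=> //; apply: (inj_comp j_inj); apply: can_inj irK.
apply: (IHn P (Q * X)%type (mk_linear su_lin) (mk_linear tp_lin)).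
  move=> y /=; have [x <-] := p_surj y.
  by rewrite sP uP tP -linearD addrC subrK.
exact: inj_dim_le_prod.
Qed.

Lemma inj_dim_leW n M : finite_coresolution (@injective_module R) n M ->
  inj_dim_le n M.
Proof.
elim: n M => [|n IHn] M /=; first exact: injective_zero.
move=> [X [Q [i [q [XX iq Qn]]]]].
by exists X, Q, i, q; split=> //; apply: IHn.
Qed.

End InjectiveModules.

(** * Complexes and dimensions *)

Section ExtendedIntegers.
Local Open Scope ereal_scope.

(** [\bar int] is a complete lattice, hence the default values in the
    definitions of the dimensions are only taken on the empty set. *)
Lemma ereal_int_sup (B : set (\bar int)) : exists s, supremums B s.
Proof.
have [Boo|Boo] := pselect (B +oo).
  by exists +oo; split=> [x _|x]; [exact: leey | exact].
have [[z0 Bz0]|Bfin] := pselect (exists z : int, B z%:E); last first.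
  exists -oo; split=> [x Bx|x _]; last exact: leNye.
  by case: x Bx => // z Bz; case: Bfin; exists z.
have [[b Bb]|unbd] :=
  pselect (exists b : int, forall z : int, B z%:E -> (z <= b)%R).
  pose P n := `[< B (b - n%:Z)%:E >].
  have exP : exists n, P n.
    exists `|b - z0|%N; apply/asboolP; rewrite gez0_abs ?subr_ge0 ?Bb //.
    by rewrite opprB addrC subrK.
  case: (ex_minnP exP) => n /asboolP Bn n_min; exists (b - n%:Z)%:E.
  split=> [x Bx|x]; last exact.
  case: x Bx => [z Bz|//|_]; last exact: leNye.
  rewrite lee_fin; have zb := Bb _ Bz.
  have /n_min : P `|b - z|%N.
    by apply/asboolP; rewrite gez0_abs ?subr_ge0 // opprB addrC subrK.
  by lia.
exists +oo; split=> [x _|x xB]; first exact: leey.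
case: x xB => [z|//|] xB.
  by case: unbd; exists z => y /xB; rewrite lee_fin.
by have := xB _ Bz0.
Qed.

Lemma ereal_int_inf (B : set (\bar int)) : exists s, infimums B s.
Proof.
have [s [s1 s2]] := ereal_int_sup (lbound B).
by exists s; split=> // x Bx; apply: s2 => y; exact.
Qed.

Lemma infimum_le (B : set (\bar int)) x0 x : B x -> infimum x0 B <= x.
Proof.
move=> Bx; rewrite /infimum; case: ifPn => [/eqP B0|_];
  first by rewrite B0 in Bx.
have [s Bs] := ereal_int_inf B.
by case: (xgetPex x0 (ex_intro _ s Bs)) => + _; exact.
Qed.

Lemma supremum_ge (B : set (\bar int)) x0 x : B x -> x <= supremum x0 B.
Proof.
move=> Bx; rewrite /supremum; case: ifPn => [/eqP B0|_];
  first by rewrite B0 in Bx.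
have [s Bs] := ereal_int_sup B.
by case: (xgetPex x0 (ex_intro _ s Bs)) => + _; exact.
Qed.

Lemma infimum_lt (B : set (\bar int)) b : infimum +oo B < b ->
  exists2 x, B x & x < b.
Proof.
move=> iB; apply: contrapT => nB.
have Bb : lbound B b.
  by move=> x Bx; rewrite leNgt; apply/negP => xb; apply: nB; exists x.
move: iB; rewrite ltNge => /negP; apply; rewrite /infimum.
case: ifPn => [_|_]; first exact: leey.
have [s Bs] := ereal_int_inf B.
by case: (xgetPex +oo (ex_intro _ s Bs)) => _; exact.
Qed.

Lemma supremum_le (B : set (\bar int)) b : ubound B b -> supremum -oo B <= b.
Proof.
move=> Bb; rewrite /supremum; case: ifPn => [_|_]; first exact: leNye.
have [s Bs] := ereal_int_sup B.
by case: (xgetPex -oo (ex_intro _ s Bs)) => _; exact.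
Qed.

End ExtendedIntegers.

Definition mk_cycle (R : comPzRingType) (V W : lmodType R) (g : {linear V -> W})
  x (gx : g x = 0) : cycles g := exist _ x (introT eqP gx).

Section Dimensions.
Variable R : comPzRingType.
Implicit Types (M N : lmodType R) (cX : lmodType R -> Prop).

Lemma cx_length_le (X : nat -> lmodType R) (n : nat) :
  (cx_length X <= n%:Z%:E)%E <-> forall k, (n < k)%N -> is_zero (X k).
Proof.
split=> [Xn k nk|X0].
  apply: contrapT => Xk; suff : (k%:Z%:E <= n%:Z%:E)%E by rewrite lee_fin; lia.
  by apply: le_trans Xn; apply: supremum_ge; exists k.
apply: supremum_le => _ [k Xk <-]; rewrite lee_fin lez_nat leqNgt.
by apply/negP => /X0.
Qed.

Lemma cx_length_fin (X : nat -> lmodType R) : (cx_length X < +oo)%E ->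
  exists n : nat, (cx_length X <= n%:Z%:E)%E.
Proof.
case: (cx_length X) => [z||] // _; last by exists 0%N.
by exists `|z|%N; rewrite lee_fin; lia.
Qed.

Lemma cochain_homology0 (X : cochain_complex R) :
  isomorphic (cycles (co_d X 0) : lmodType R) (cochain_homology X 0).
Proof.
have [q q_surj qP] := homology_piP (\0 : {linear 'rV[R]_0 -> X 0%N}) (co_d X 0).
exists q; suff q_inj : injective q.
  by have [s sP] := choice q_surj; exists s => // z; apply: q_inj; rewrite sP.
apply: linear_inj0 => z /qP[u uz]; apply: val_inj.
by rewrite linear0 -uz.
Qed.

Lemma cochain_homologyS (X : cochain_complex R) n :
  is_zero (cochain_homology X n.+1) <->
  forall x, co_d X n.+1 x = 0 -> exists y, co_d X n y = x.
Proof.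
have [q q_surj qP] := homology_piP (co_d X n) (co_d X n.+1).
split=> [H0 x dx|ex h].
  have /qP := H0 (q (mk_cycle dx)); exact.
have [z <-] := q_surj h; apply/qP; apply: ex.
by apply/eqP; apply: (valP z).
Qed.

Lemma finite_coresolution_iso cX n M N : isomorphic M N ->
  finite_coresolution cX n M -> finite_coresolution cX n N.
Proof.
move=> /isomorphic_sym[f /bijective_linearV[g fK gK]]; case: n => [|n] /=.
  by move=> M0 x; rewrite -[x]fK (M0 (f x)) linear0.
move=> [X [Q [i [q [XX [i_inj q_surj qP] Qn]]]]].
exists X, Q, (i \o f : {linear N -> X}), q; split=> //; split=> //.
  by apply: inj_comp => //; apply: can_inj fK.
move=> x; rewrite qP; split=> [[m <-]|[m <-]]; last by exists (f m).
by exists (g m); rewrite /= gK.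
Qed.

(** The successive cokernels are the modules of cycles of the complex. *)
Lemma coresolution_cycles cX M (X : cochain_complex R) n :
  is_coresolution cX M X -> (forall k, (n <= k)%N -> is_zero (X k)) ->
  finite_coresolution cX n M.
Proof.
move=> [XX MX Xex] X0.
suff Zn k j : (j + k)%N = n -> finite_coresolution cX k (cycles (co_d X j)).
  apply: finite_coresolution_iso (Zn n 0%N (add0n n)).
  exact: isomorphic_trans (cochain_homology0 X) MX.
elim: k j => [|k IHk] j jk /=.
  by move=> z; apply: val_inj; rewrite [LHS](X0 j) ?linear0 //; lia.
have [z|q qP] := factor_inj
  (i := \val : {linear cycles (co_d X j.+1) -> X j.+1}) (f := co_d X j) val_inj.
  by exists (mk_cycle (co_dd z)).
exists (X j), (cycles (co_d X j.+1) : lmodType R),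
  (\val : {linear cycles (co_d X j) -> X j}), q.
split; [exact: XX| |by apply: IHk; lia].
split=> [|z|x]; first exact: val_inj.
  have [|y yz] := (cochain_homologyS X j).1 (Xex j) (val z).
    by apply/eqP; apply: (valP z).
  by exists y; apply: val_inj; rewrite qP.
split=> [qx|[z <-]].
  have dx : co_d X j x = 0 by rewrite -qP qx linear0.
  by exists (mk_cycle dx).
by apply: val_inj; rewrite qP linear0; apply/eqP/(valP z).
Qed.

Lemma inj_dim_fin cX M : ~ is_zero M -> (inj_dim cX M < +oo)%E ->
  exists n, finite_coresolution cX n M.
Proof.
move=> M_n0; rewrite /inj_dim; case: asboolP => // _ /infimum_lt[_ [X XM ->]].
move=> /cx_length_fin[n /cx_length_le X0]; exists n.+1.
exact: coresolution_cycles XM X0.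
Qed.

Lemma proj_dim0 cX M : proj_dim cX M = 0%E ->
  ~ is_zero M /\ exists2 X, cX X & isomorphic X M.
Proof.
rewrite /proj_dim; case: asboolP => // M_n0 d0; split=> //.
have : (0 < 1 :> \bar int)%E by rewrite lte_fin.
rewrite -{1}d0 => /infimum_lt[_ [X [XX MX _] ->] X1]; exists (X 0%N) => //;
  apply: isomorphic_trans MX.
have X1_0 : is_zero (X 1%N).
  by apply: (cx_length_le X 0).1.
have [q q_surj qP] := homology_piP (ch_d X 0) (\0 : {linear X 0%N -> 'rV[R]_0}).
have [|r rP] := factor_inj
  (i := \val : {linear cycles (\0 : {linear X 0%N -> 'rV[R]_0}) -> X 0%N})
  (f := idfun) val_inj.
  by move=> x; exists (mk_cycle (erefl : \0 x = 0)).
exists (q \o r : {linear X 0%N -> _}).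
have qr_inj : injective (q \o r).
  by apply: linear_inj0 => x /= /qP[u]; rewrite rP (X1_0 u) linear0 => /esym.
have /choice[s sP] : forall h, exists x, q (r x) = h.
  move=> h; have [z <-] := q_surj h; exists (val z); congr (q _).
  by apply: val_inj; rewrite rP.
by exists s => x; [apply: qr_inj; rewrite /= sP | exact: sP].
Qed.

Section Splice.
Variables (E : lmodType R) (X : cochain_complex R) (d : {linear E -> X 0%N}).
Hypothesis dd : forall x, co_d X 0 (d x) = 0.

Definition splice_obj k : lmodType R := if k is j.+1 then X j else E.

Definition splice_d k : {linear splice_obj k -> splice_obj k.+1} :=
  match k with 0 => d | j.+1 => co_d X j end.

Fact splice_dd k x : splice_d k.+1 (splice_d k x) = 0.
Proof. by case: k x => [|k] x /=; rewrite ?co_dd. Qed.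

(** The complex [E -> X 0 -> X 1 -> ...]. *)
Definition splice : cochain_complex R := CochainComplex splice_dd.

End Splice.

(** [e] exhibits [X] as an injective coresolution of [N] that is zero above
    degree [n]. *)
Definition injective_augmented N n (X : cochain_complex R)
    (e : {linear N -> X 0%N}) : Prop :=
  [/\ forall k, injective_module (X k), forall k, (n < k)%N -> is_zero (X k),
    injective e, forall x, co_d X 0 x = 0 <-> exists a, e a = x
  & forall k x, co_d X k.+1 x = 0 -> exists y, co_d X k y = x].

Lemma injective_augmented_splice (N E Q : lmodType R) n (i : {linear N -> E})
    (q : {linear E -> Q}) (X : cochain_complex R) (e : {linear Q -> X 0%N}) :
  injective_module E -> short_exact i q -> injective_augmented n e ->
  exists (X' : cochain_complex R) (e' : {linear N -> X' 0%N}),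
    injective_augmented n.+1 e'.
Proof.
move=> E_inj [i_inj q_surj qP] [X_inj X0 e_inj eP Xex].
have eq0 x : co_d X 0 (e (q x)) = 0 by apply/eP; exists (q x).
exists (splice (d := e \o q : {linear E -> X 0%N}) eq0), i; split=> //.
- by case.
- by case=> // k nk; apply: X0.
- move=> x; rewrite -qP /=; split=> [eqx|->]; last exact: linear0.
  by apply: e_inj; rewrite eqx linear0.
- case=> [|k] x /=; last exact: Xex.
  by move=> /eP[a <-]; have [y <-] := q_surj a; exists y.
Qed.

Lemma inj_dim_le_complex n N : inj_dim_le n N ->
  exists m (X : cochain_complex R) (e : {linear N -> X 0%N}),
    injective_augmented m e.
Proof.
have rV0 (x : 'rV[R]_0) : x = 0 by apply/rowP => -[].
elim: n N => [|n IHn] N /=; last first.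
  move=> [E [Q [i [q [E_inj iq /IHn[m [X [e eX]]]]]]]].
  by exists m.+1; apply: injective_augmented_splice E_inj iq eX.
move=> N_inj; exists 1%N.
pose X : cochain_complex R := @CochainComplex R (fun=> 'rV[R]_0) (fun=> \0)
  (fun _ _ => erefl).
apply: (injective_augmented_splice (X := X) (i := idfun : {linear N -> N})
  (q := \0 : {linear N -> 'rV[R]_0}) (e := idfun)) => //.
  split=> // [w|v]; first by exists 0; rewrite (rV0 w).
  by split=> // _; exists v.
split=> //= [k|x]; first exact: injective_zero.
by split=> // _; exists x.
Qed.

Lemma inj_dim_lty n N : inj_dim_le n N ->
  (inj_dim (@injective_module R) N < +oo)%E.
Proof.
move=> /inj_dim_le_complex[m [X [e [X_inj X0 e_inj eP Xex]]]].
rewrite /inj_dim; case: asboolP => [//|_].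
have resX : is_coresolution (@injective_module R) N X.
  split=> // [|k]; last by apply/cochain_homologyS => x /Xex.
  have [//|f fP] := factor_inj (i := \val : {linear cycles (co_d X 0) -> X 0%N})
    (f := e) val_inj.
    move=> a; have ea : co_d X 0 (e a) = 0 by apply/eP; exists a.
    by exists (mk_cycle ea).
  apply: isomorphic_sym; apply: isomorphic_trans (cochain_homology0 X).
  have f_inj : injective f.
    by move=> a b ab; apply: e_inj; rewrite -!fP ab.
  have /choice[s sP] : forall z, exists a, f a = z.
    move=> z; have /eP[a ea] : co_d X 0 (val z) = 0 by apply/eqP/(valP z).
    by exists a; apply: val_inj; rewrite fP.
  by exists f; exists s => a; [apply: f_inj; rewrite sP | exact: sP].
have Xm : (cx_length X <= m%:Z%:E)%E by apply/cx_length_le.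
apply: (@le_lt_trans _ _ m%:Z%:E); last exact: ltry.
by apply: le_trans Xm; apply: infimum_le; exists X.
Qed.

End Dimensions.

(** * Matrices acting on tuples of module elements *)

Section MatrixAction.
Variable R : comPzRingType.
Implicit Types U V : lmodType R.

(** The linear combination of the entries of [x] with coefficients [a]. *)
Definition comb_fun V n (x : {ffun 'I_n -> V}) (a : 'rV[R]_n) : V :=
  \sum_k a 0 k *: x k.

Fact comb_fun_linear V n (x : {ffun 'I_n -> V}) : linear (comb_fun x).
Proof.
move=> c a b; rewrite /comb_fun scaler_sumr -big_split; apply: eq_bigr => k _.
by rewrite /= !mxE scalerDl scalerA.
Qed.

Definition comb V n (x : {ffun 'I_n -> V}) : {linear 'rV[R]_n -> V} :=
  mk_linear (comb_fun_linear x).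

(** The matrix [A] times the column [x] with entries in [V]; for [A : 'M_(m, n)]
    seen as a map [R^m -> R^n], this is [Hom(A, V)], while the transpose of [A]
    acts as the tensor product of [A] and [V]. *)
Definition act_fun V m n (A : 'M[R]_(m, n)) (x : {ffun 'I_n -> V}) :
  {ffun 'I_m -> V} := [ffun j => \sum_k A j k *: x k].

Fact act_fun_linear V m n (A : 'M[R]_(m, n)) : linear (@act_fun V m n A).
Proof.
move=> c x y; apply/ffunP => j; rewrite !ffunE scaler_sumr -big_split.
by apply: eq_bigr => k _; rewrite /= !ffunE scalerDr !scalerA mulrC.
Qed.

Definition act V m n (A : 'M[R]_(m, n)) :
  {linear {ffun 'I_n -> V} -> {ffun 'I_m -> V}} :=
    mk_linear (@act_fun_linear V m n A).

Lemma actE V m n (A : 'M[R]_(m, n)) (x : {ffun 'I_n -> V}) j :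
  act V A x j = \sum_k A j k *: x k.
Proof. by rewrite ffunE. Qed.

Lemma act_mulmx V m n p (A : 'M[R]_(m, n)) (B : 'M[R]_(n, p)) x :
  act V (A *m B) x = act V A (act V B x).
Proof.
apply/ffunP => j; rewrite !actE.
under eq_bigr do rewrite mxE scaler_suml.
rewrite exchange_big; apply: eq_bigr => k _; rewrite actE scaler_sumr.
by apply: eq_bigr => l _; rewrite scalerA.
Qed.

Lemma comb_mulmx V m n (A : 'M[R]_(m, n)) (x : {ffun 'I_n -> V}) a :
  comb x (a *m A) = comb (act V A x) a.
Proof.
rewrite /= /comb_fun.
under eq_bigr do rewrite mxE scaler_suml.
rewrite exchange_big; apply: eq_bigr => k _; rewrite ffunE scaler_sumr.
by apply: eq_bigr => l _; rewrite scalerA.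
Qed.

Lemma comb0 V n (a : 'rV[R]_n) : comb (0 : {ffun 'I_n -> V}) a = 0.
Proof. by apply: big1 => k _; rewrite ffunE scaler0. Qed.

Lemma comb_delta V n (x : {ffun 'I_n -> V}) k : comb x (delta_mx 0 k) = x k.
Proof.
rewrite /= /comb_fun (bigD1 k) //= big1 => [|j jk].
  by rewrite mxE !eqxx scale1r addr0.
by rewrite mxE eqxx (negPf jk) scale0r.
Qed.

Lemma comb_linear U V n (f : {linear U -> V}) (x : {ffun 'I_n -> U}) a :
  f (comb x a) = comb [ffun k => f (x k)] a.
Proof.
by rewrite /= /comb_fun linear_sum; apply: eq_bigr => k _;
  rewrite linearZ ffunE.
Qed.

Lemma act_linear U V m n (A : 'M[R]_(m, n)) (f : {linear U -> V})
    (x : {ffun 'I_n -> U}) j :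
  f (act U A x j) = act V A [ffun k => f (x k)] j.
Proof.
by rewrite !actE linear_sum; apply: eq_bigr => k _; rewrite linearZ ffunE.
Qed.

Lemma linear_comb V n (f : {linear 'rV[R]_n -> V}) a :
  f a = comb [ffun k => f (delta_mx 0 k)] a.
Proof.
rewrite {1}[a]row_sum_delta linear_sum /= /comb_fun; apply: eq_bigr => k _.
by rewrite linearZ ffunE.
Qed.

Lemma projective_rV n : projective ('rV[R]_n : lmodType R).
Proof.
move=> U V g f g_surj.
have /choice[u uP] k : exists u, g u = f (delta_mx 0 k) by exact: g_surj.
exists (comb [ffun k => u k]) => a.
rewrite comb_linear [RHS]linear_comb; congr (comb _ a).
by apply/ffunP => k; rewrite !ffunE uP.
Qed.

Lemma hom_sumE U V (I : finType) (F : I -> {linear U -> V}) x :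
  (\sum_i F i) x = \sum_i F i x.
Proof. by apply: (big_morph (fun f : {linear U -> V} => f x)). Qed.

(** The tuple with entry [c] at [k] and zero elsewhere. *)
Definition single V n (k : 'I_n) (c : V) : {ffun 'I_n -> V} :=
  [ffun j => if j == k then c else 0].

Fact single_linear V n (k : 'I_n) : linear (@single V n k).
Proof.
move=> a x y; apply/ffunP => j; rewrite !ffunE.
by case: eqP => _ //; rewrite scaler0 addr0.
Qed.

(** As [I] is injective, [Hom(_, I)] turns the kernel of [B] acting on tuples
    of [C] into the image of the transpose of [B] acting on tuples of [Hom(C,
    I)]. *)
Lemma hom_exact (C I : lmodType R) q r (B : 'M[R]_(r, q))
    (v : {ffun 'I_q -> {linear C -> I}}) : injective_module I ->
  (forall x : {ffun 'I_q -> C}, act C B x = 0 -> \sum_k v k (x k) = 0) ->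
  exists w, v = act {linear C -> I} B^T w.
Proof.
move=> I_inj Bv.
have ev_lin : linear (fun x : {ffun 'I_q -> C} => \sum_k v k (x k)).
  move=> a x y; rewrite scaler_sumr -big_split; apply: eq_bigr => k _.
  by rewrite !ffunE linearP.
have [h hP] := injective_factor (b := act C B) (f := mk_linear ev_lin) I_inj Bv.
exists [ffun j => h \o mk_linear (@single_linear C r j) : {linear C -> I}].
apply/ffunP => k; apply: linear_ext => c; rewrite actE hom_sumE.
have := hP (single k c); rewrite mk_linearE (bigD1 k) //= big1; last first.
  by move=> j jk; rewrite ffunE (negPf jk) linear0.
rewrite addr0 ffunE eqxx => <-.
have -> : act_fun B (single k c) = \sum_j B j k *: single j c.
  apply/ffunP => j; rewrite ffunE (bigD1 k) //= big1 => [|l lk]; last first.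
    by rewrite ffunE (negPf lk) scaler0.
  rewrite sum_ffunE (bigD1 j) //= big1 => [|l lj]; last first.
    by rewrite !ffunE eq_sym (negPf lj) scaler0.
  by rewrite !ffunE !eqxx.
by rewrite linear_sum; apply: eq_bigr => j _; rewrite linearZ mxE ffunE.
Qed.

End MatrixAction.

(** * Noetherian rings and free resolutions *)

Section Noetherian.
Variables (R : comPzRingType) (R_noeth : noetherian R).

(** Submodules of [R^n] are finitely generated: by induction on [n], from the
    ideal of first coordinates and the submodule of vectors with first
    coordinate 0. *)
Lemma noetherian_row n (S : 'rV[R]_n -> Prop) :
  S 0 -> (forall a x y, S x -> S y -> S (a *: x + y)) ->
  exists m (A : 'M[R]_(m, n)), forall v, S v <-> exists a, v = a *m A.
Proof.
elim: n S => [|n IHn] S S0 SP.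
  exists 0%N, 0 => v; split=> [_|_]; last by rewrite (_ : v = 0) //;
    apply/rowP => -[].
  by exists 0; apply/rowP => -[].
have S_sum p (a : 'rV_p) (W : 'M_(p, n.+1)) :
    (forall j, S (row j W)) -> S (a *m W).
  move=> SW; rewrite mulmx_sum_row; elim/big_ind: _ => // [x y Sx Sy|j _].
    by rewrite -[x]scale1r; apply: SP.
  by rewrite -[_ *: _]addr0; apply: SP.
pose J : set R := fun x : R => exists2 v, S v & v 0 ord0 = x.
have J_ideal : is_ideal J.
  split=> [|x y [v Sv <-] [w Sw <-]|a x [v Sv <-]].
  - by exists 0 => //; rewrite mxE.
  - by exists (1 *: v + w); [exact: SP | rewrite !mxE mul1r].
  - by exists (a *: v + 0); [exact: SP | rewrite !mxE addr0].
have [p [g gP]] := R_noeth J_ideal.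
have /choice[w wP] j : exists v, S v /\ v 0 ord0 = g j.
  suff [v Sv vg] : exists2 v, S v & v 0 ord0 = g j by exists v.
  rewrite -[exists2 v, _ & _]/(J (g j)) gP.
  exists (fun k => (k == j)%:R);
    rewrite (bigD1 j) //= eqxx mul1r big1 ?addr0 //.
  by move=> k kj; rewrite (negPf kj) mul0r.
have [||m [A AP]] := IHn (fun v => S (row_mx (0 : 'M_1) v : 'rV_n.+1)).
- by rewrite row_mx0.
- move=> a x y Sx Sy; rewrite -[X in row_mx X _](addr0 0) -add_row_mx.
  by rewrite -[X in row_mx X _](scaler0 _ a) -scale_row_mx; apply: SP.
exists (p + m)%N,
  (col_mx (\matrix_j w j) (row_mx (0 : 'cV_m) A) : 'M_(_, n.+1)).
move=> v; split=> [Sv|[a ->]]; last first.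
  apply: S_sum => j; case: (splitP j) => k jk.
    have -> : j = lshift m k by apply: val_inj.
    by rewrite rowKu rowK; case: (wP k).
  have -> : j = rshift p k by apply: val_inj.
  rewrite rowKd (@row_row_mx _ m 1 n) row0; apply/AP.
  by exists (delta_mx 0 k); rewrite rowE.
have [a aP] : exists a : 'I_p -> R, v 0 ord0 = \sum_i a i * g i.
  suff : J (v 0 ord0) by rewrite gP.
  by exists v.
pose W : 'M_(p, n.+1) := \matrix_j w j.
have Su : S ((- (\row_j a j *m W)) + v).
  rewrite -scaleN1r; apply: SP => //; apply: S_sum => j.
  by rewrite rowK; case: (wP j).
set u : 'rV_(1 + n) := _ + v in Su.
have u0 : lsubmx u = 0.
  apply/rowP => j; rewrite !ord1 !mxE (_ : lshift n 0 = ord0);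
    last exact: val_inj.
  apply/eqP; rewrite addrC subr_eq0 aP; apply/eqP/eq_bigr => k _.
  by rewrite !mxE; case: (wP k) => _ ->.
have /AP[b bP] : S (row_mx (0 : 'M_1) (rsubmx u)) by rewrite -u0 hsubmxK.
exists (row_mx (\row_j a j) b);
  rewrite mul_row_col (@mul_mx_row _ 1 m 1 n) mulmx0 -bP -u0 hsubmxK.
by rewrite /u addrA subrr add0r.
Qed.

Lemma noetherian_syzygy (V : lmodType R) n (f : {linear 'rV[R]_n -> V}) :
  exists m (A : 'M[R]_(m, n)), forall v, f v = 0 <-> exists a, v = a *m A.
Proof.
apply: noetherian_row; first exact: linear0.
by move=> a x y ex ey; rewrite linearP ex ey scaler0 addr0.
Qed.

(** [n] and [A] are the ranks and the matrices of the differentials of a free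
    resolution of [C] augmented by the generators [g]. *)
Definition free_resolution (C : lmodType R) (n : nat -> nat)
    (A : forall i, 'M[R]_(n i.+1, n i)) (g : {ffun 'I_(n 0%N) -> C}) : Prop :=
  [/\ forall x, exists a, comb g a = x,
    forall a, comb g a = 0 <-> exists b, a = b *m A 0%N
  & forall i (a : 'rV_(n i.+1)), a *m A i = 0 <-> exists b, a = b *m A i.+1].

Lemma free_resolution_exists (C : lmodType R) : fin_gen C ->
  exists n (A : forall i, 'M[R]_(n i.+1, n i)) (g : {ffun 'I_(n 0%N) -> C}),
    free_resolution A g.
Proof.
move=> [n0 [g gP]].
(* A state is a matrix of the resolution, with its dimensions; the next one
   presents its syzygies. *)
pose state := {s : nat * nat & 'M[R]_(s.2, s.1)}.
have syz (s : state) : {k : nat & {B : 'M[R]_(k, (tag s).2) |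
    forall a : 'rV_(tag s).2, a *m tagged s = 0 <-> exists b, a = b *m B}}.
  pose f : {linear 'rV[R]_(tag s).2 -> 'rV[R]_(tag s).1} := mulmxr (tagged s).
  by have /cid[k /cid[B BP]] := noetherian_syzygy f; exists k, B.
pose next (s : state) : state :=
  existT _ ((tag s).2, tag (syz s)) (sval (tagged (syz s))).
have [m [A0 A0P]] := noetherian_syzygy (comb [ffun k => g k]).
pose st i := iter i next (existT _ (n0, m) A0).
exists (fun i => (tag (st i)).1), (fun i => tagged (st i)), [ffun k => g k].
split=> [x||i a].
- have [a ->] := gP x; exists (\row_k a k); apply: eq_bigr => k _.
  by rewrite mxE ffunE.
- exact: A0P.
- exact: (svalP (tagged (syz (st i)))).
Qed.

End Noetherian.

Section ExtOfFree.
Variables (R : comPzRingType) (C : lmodType R) (n : nat -> nat).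
Variables (A : forall i, 'M[R]_(n i.+1, n i)) (g : {ffun 'I_(n 0%N) -> C}).
Hypothesis A_res : free_resolution A g.

Fact free_complex_dd i (a : 'rV[R]_(n i.+2)) :
  mulmxr (A i) (mulmxr (A i.+1) a) = 0.
Proof. by case: A_res => _ _ Aex; apply/Aex; exists a. Qed.

Definition free_complex : chain_complex R :=
  @ChainComplex R (fun i => 'rV[R]_(n i)) (fun i => mulmxr (A i))
    free_complex_dd.

Lemma free_complex_resolution : is_resolution (@projective R) C free_complex.
Proof.
have [gP A0P AP] := A_res; split=> [i||i].
- exact: projective_rV.
- have [q q_surj qP] := homology_piP (ch_d free_complex 0)
    (\0 : {linear free_complex 0%N -> 'rV[R]_0}).
  have [z|h hP] := factor_surj (f := comb g \o \val : {linear _ -> C}) q_surj.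
    by move=> /qP[a az]; apply/A0P; exists a; apply: esym az.
  exists h; have h_inj : injective h.
    apply: linear_inj0 => x; have [z <-] := q_surj x; rewrite hP => /A0P[a az].
    by apply/qP; exists a.
  have /choice[s sP] : forall c, exists x, h x = c.
    move=> c; have [a <-] := gP c; exists (q (exist _ a (eqxx _))).
    by rewrite hP.
  by exists s => c; [apply: h_inj; rewrite sP | exact: sP].
- have [q q_surj qP] :=
    homology_piP (ch_d free_complex i.+1) (ch_d free_complex i).
  move=> x; have [z <-] := q_surj x; apply/qP.
  have /AP[a az] : val z *m A i = 0 by apply/eqP/(valP z).
  by exists a.
Qed.

Lemma ext_vanishes_exact i (V : lmodType R) (x : {ffun 'I_(n i.+1) -> V}) :
  Ext_vanishes i.+1 C V -> act V (A i.+1) x = 0 -> exists y, x = act V (A i) y.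
Proof.
move=> /(_ _ free_complex_resolution)/cochain_homologyS Vex Ax.
have [|y yx] := Vex (comb x).
  apply: linear_ext => a; apply: etrans (comb_mulmx (A i.+1) x a) _.
  by rewrite Ax comb0.
exists [ffun l => y (delta_mx 0 l)]; apply/ffunP => k.
by rewrite -comb_delta -yx /= linear_comb comb_mulmx comb_delta.
Qed.

(** A tuple [x] that satisfies the relations between the generators [g] defines
    an endomorphism of [C], which is a homothety. *)
Lemma homothety_exact (x : {ffun 'I_(n 0%N) -> C}) :
  bijective (homothety C) -> act C (A 0%N) x = 0 ->
  exists a : R, forall k, x k = a *: g k.
Proof.
have [gP A0P _] := A_res; move=> [hinv _ hK] Ax.
have [a|h hP] := factor_surj (f := comb x) gP.
  by move=> /A0P[b ->]; rewrite comb_mulmx Ax comb0.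
exists (hinv h) => k.
by rewrite -comb_delta -hP comb_delta -[h in LHS]hK.
Qed.

End ExtOfFree.

(** * Coresolutions by the modules Hom(C, I) *)

Section FoxbyEquivalence.
Variables (R : comPzRingType) (C : lmodType R) (n : nat -> nat).
Variables (A : forall i, 'M[R]_(n i.+1, n i)) (g : {ffun 'I_(n 0%N) -> C}).
Hypotheses (A_res : free_resolution A g) (C_sd : semidualizing C).
Implicit Types M N X Q I : lmodType R.

Lemma resolution_act0 : act C (A 0%N) g = 0.
Proof.
have [_ A0P _] := A_res; apply/ffunP => j.
rewrite -comb_delta -comb_mulmx ffunE; apply/A0P.
by exists (delta_mx 0 j).
Qed.

Lemma resolution_mul0 i : A i.+1 *m A i = 0.
Proof.
have [_ _ AP] := A_res; apply/row_matrixP => j; rewrite row0 rowE mulmxA.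
by apply/AP; exists (delta_mx 0 j).
Qed.

(** Vanishing of Tor_i(C, N) for all positive [i], computed with the resolution
    [A]; the index [i] below stands for the degree [i.+1]. *)
Definition tor_vanishes N : Prop := forall i (v : {ffun 'I_(n i.+1) -> N}),
  act N (A i)^T v = 0 -> exists w, v = act N (A i.+1)^T w.

Lemma sum_hom_act I q r (B : 'M[R]_(q, r)) (v : {ffun 'I_q -> {linear C -> I}})
    (y : {ffun 'I_r -> C}) :
  \sum_k v k (act C B y k) = \sum_l act {linear C -> I} B^T v l (y l).
Proof.
under eq_bigr do rewrite actE linear_sum.
rewrite exchange_big; apply: eq_bigr => l _; rewrite actE hom_sumE.
by apply: eq_bigr => k _; rewrite linearZ mxE.
Qed.

Lemma tor_vanishes_hom I : injective_module I -> tor_vanishes {linear C -> I}.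
Proof.
move=> I_inj i v Av; apply: hom_exact => // x.
have [_ _ C_ext] := C_sd.
move=> /(ext_vanishes_exact A_res (C_ext i.+1 isT))[y ->].
by rewrite sum_hom_act Av big1 // => l _; rewrite ffunE.
Qed.

(** The evaluation map from the tensor product of [C] and [Hom(C, I)] to [I] is
    injective. An element of the tensor product of [C] and [X] is written as a
    tuple [v] of coefficients in [X] of the generators [g]; it is zero when [v]
    is in the image of the transpose of [A 0]. *)
Lemma evaluation_inj I (v : {ffun 'I_(n 0%N) -> {linear C -> I}}) :
  injective_module I -> \sum_k v k (g k) = 0 ->
  exists w, v = act {linear C -> I} (A 0%N)^T w.
Proof.
move=> I_inj vg; apply: hom_exact => // x Ax.
have [_ C_hom _] := C_sd; have [a xE] := homothety_exact A_res C_hom Ax.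
under eq_bigr do rewrite xE linearZ.
by rewrite -scaler_sumr vg scaler0.
Qed.

(** If [v] is the boundary of a tuple [w] with entries in [X], then the image
    of [w] in [Q] is a cycle, hence a boundary, and correcting [w] accordingly
    puts it in [N]. For [j = 0] this is the exactness of the tensor product of
    [C] with the sequence, for [j > 0] the vanishing of Tor of [N]. *)
Lemma tor_chase N X Q (i : {linear N -> X}) (q : {linear X -> Q}) j
    (v : {ffun 'I_(n j) -> N}) (w : {ffun 'I_(n j.+1) -> X}) :
  short_exact i q -> tor_vanishes Q ->
  [ffun k => i (v k)] = act X (A j)^T w -> exists w', v = act N (A j)^T w'.
Proof.
move=> [i_inj q_surj qP] Q_tor vw.
have [|z zP] := Q_tor j [ffun k => q (w k)].
  apply/ffunP => k; rewrite -act_linear -vw !ffunE.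
  by apply/qP; exists (v k).
have /choice[zx zxP] k : exists x, q x = z k by exact: q_surj.
pose w0 : {ffun 'I_(n j.+1) -> X} := w - act X (A j.+1)^T [ffun k => zx k].
have /choice[w' wP] k : exists m, i m = w0 k.
  apply/qP; rewrite !ffunE linearB.
  have /ffunP/(_ k) := zP; rewrite ffunE => ->.
  rewrite -[X in q X](actE (A j.+1)^T [ffun k => zx k] k) act_linear.
  apply/eqP; rewrite subr_eq0; apply/eqP; congr (act Q _ _ k).
  by apply/ffunP => l; rewrite !ffunE zxP.
exists [ffun k => w' k]; apply/ffunP => k; apply: i_inj.
rewrite act_linear.
have -> : [ffun l => i ([ffun k => w' k] l)] = w0.
  by apply/ffunP => l; rewrite -wP !ffunE.
rewrite /w0 linearB -act_mulmx -trmx_mul resolution_mul0 trmx0.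
have -> : act X (0 : 'M_(n j, n j.+2)) [ffun k => zx k] = 0.
  by apply/ffunP => l; rewrite actE ffunE big1 // => m _; rewrite mxE scale0r.
by rewrite subr0 -vw ffunE.
Qed.

Lemma tor_vanishes_ker N X Q (i : {linear N -> X}) (q : {linear X -> Q}) :
  short_exact i q -> tor_vanishes X -> tor_vanishes Q -> tor_vanishes N.
Proof.
move=> iq X_tor Q_tor j v Av.
have [|w wP] := X_tor j [ffun k => i (v k)].
  by apply/ffunP => k; rewrite -act_linear Av !ffunE linear0.
exact: tor_chase iq Q_tor wP.
Qed.

Lemma finite_coresolution_hom k M : finite_coresolution (class_IC C) k.+1 M ->
  exists I Q (i : {linear M -> {linear C -> I}})
      (q : {linear {linear C -> I} -> Q}),
    [/\ injective_module I, short_exact i q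
      & finite_coresolution (class_IC C) k Q].
Proof.
move=> [X [Q [i [q [[I I_inj [f /bijective_linearV[h fK hK]]] [i_inj q_surj qP]
  Qk]]]]].
exists I, Q, (f \o i : {linear _ -> _}), (q \o h : {linear _ -> _});
  split=> //; split.
- by apply: inj_comp => //; apply: can_inj fK.
- by move=> w; have [x <-] := q_surj w; exists (f x); rewrite /= fK.
- move=> x; rewrite /= qP; split=> [[m em]|[m <-]]; exists m;
    last by rewrite /= fK.
  by rewrite /= em hK.
Qed.

Lemma tor_vanishes_coresolution k M :
  finite_coresolution (class_IC C) k M -> tor_vanishes M.
Proof.
elim: k M => [|k IHk] M.
  by move=> M0 i v _; exists 0; apply/ffunP => j; rewrite [LHS]M0 [RHS]M0.
move=> /finite_coresolution_hom[I [Q [i [q [I_inj iq /IHk Q_tor]]]]].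
by apply: tor_vanishes_ker iq (tor_vanishes_hom I_inj) Q_tor.
Qed.

Lemma coresolution_embedding k Q : finite_coresolution (class_IC C) k Q ->
  exists I (j : {linear Q -> {linear C -> I}}),
    injective_module I /\ injective j.
Proof.
case: k => [Q0|k].
  exists 'rV[R]_0, \0; split; last by move=> x y _; rewrite [LHS]Q0 [RHS]Q0.
  by apply: injective_zero => x; apply/rowP => -[].
move=> /finite_coresolution_hom[I [Q' [i [q [I_inj [i_inj _ _] _]]]]].
by exists I, i.
Qed.

(** Here [M] is identified with a submodule of [Hom(C, I)], and [i m c] is the
    image of the tensor [c (x) m] under evaluation. *)
Section Embedding.
Variables (M I Q : lmodType R) (i : {linear M -> {linear C -> I}}).
Variables (q : {linear {linear C -> I} -> Q}) (k : nat).
Hypotheses (I_inj : injective_module I) (iq : short_exact i q).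
Hypothesis Q_cores : finite_coresolution (class_IC C) k Q.

(** The tensor product of [C] and [M] embeds in [I] by evaluation. *)
Lemma tensor_embedding (v : {ffun 'I_(n 0%N) -> M}) :
  \sum_l i (v l) (g l) = 0 -> exists w, v = act M (A 0%N)^T w.
Proof.
move=> ivg; have [|w wP] := evaluation_inj (v := [ffun l => i (v l)]) I_inj.
  by under eq_bigr do rewrite ffunE.
exact: tor_chase iq (tor_vanishes_coresolution Q_cores) wP.
Qed.

(** The map [d] from [Hom(C, I)] to [Hom(C, J)], whose kernel is [M], is
    induced by a map from the submodule of [I] spanned by evaluations, in the
    sense that [phi c = psi c'] implies [d phi c = d psi c']. So [d phi c] only
    depends on [phi c], and vanishes when [phi c] is a value of an element of
    [M]. *)
Lemma hom_into_image (phi : {linear C -> I}) :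
  (forall c, exists m c', phi c = i m c') -> exists m, i m = phi.
Proof.
move=> phiM; have [i_inj q_surj qP] := iq.
have [J [j [J_inj j_inj]]] := coresolution_embedding Q_cores.
apply/qP/j_inj; rewrite linear0; apply: linear_ext => c /=.
have [m [c' e]] := phiM c; have [gP _ _] := A_res.
have [a ac] := gP c; have [a' ac'] := gP c'.
pose v : {ffun 'I_(n 0%N) -> {linear C -> I}} :=
  [ffun l => a 0 l *: phi - a' 0 l *: i m].
have sumE (J' : lmodType R) (psi chi : {linear C -> J'}) :
    \sum_l (a 0 l *: psi - a' 0 l *: chi) (g l) = psi c - chi c'.
  rewrite -ac -ac' (comb_linear psi) (comb_linear chi) /= /comb_fun -sumrB.
  by apply: eq_bigr => l _; rewrite !ffunE.
have [|w wP] := evaluation_inj (v := v) I_inj.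
  under eq_bigr do rewrite ffunE.
  by rewrite sumE e subrr.
pose d : {linear {linear C -> I} -> {linear C -> J}} := j \o q.
have dim : d (i m) = 0.
  by rewrite /d /= (_ : q (i m) = 0) ?linear0 //; apply/qP; exists m.
have := sumE J (d phi) (d (i m)); rewrite dim subr0 => <-.
have dv l : a 0 l *: d phi - a' 0 l *: d (i m) = d (v l).
  by rewrite ffunE linearB !linearZ.
have d_act l : d (v l) = act {linear C -> J} (A 0%N)^T [ffun k => d (w k)] l.
  by rewrite wP act_linear.
transitivity (\sum_l act {linear C -> J} (A 0%N)^T [ffun k => d (w k)] l (g l)).
  by apply: eq_bigr => l _; rewrite -d_act -dv dim.
rewrite -sum_hom_act resolution_act0 big1 // => l _.
by rewrite (_ : (0 : {ffun _ -> C}) l = 0) ?linear0 // ffunE.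
Qed.

(** If the multiplication by [s] on [C] factors through [M], then an
    endomorphism of the tensor square of [C] becomes a homothety after
    multiplication by [s]; the endomorphism taken here is the swap of the two
    factors. An equality in the tensor square is expressed by means of all
    bilinear maps. *)
Lemma tensor_swap (y : {linear C -> M}) (f : {linear M -> C}) (s : R) :
  (forall c, f (y c) = s *: c) ->
  exists u : R, forall (Z : lmodType R) (b : C -> C -> Z), bilinear_map b ->
    forall c c', s *: b c c' = u *: b c' c.
Proof.
move=> fy; have [i_inj q_surj qP] := iq.
have phi_lin c : linear (fun c' => i (y c') c).
  by move=> a x z; rewrite !linearP.
have Phi_lin : linear (fun c => mk_linear (phi_lin c)).
  by move=> a x z; apply: linear_ext => c'; rewrite mk_linearE linearP.
have [c|m mP] := factor_inj (f := mk_linear Phi_lin) i_inj.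
  by apply: hom_into_image => c'; exists (y c'), c.
have [_ [hinv _ hK] _] := C_sd.
pose u := hinv (f \o m : {linear C -> C}).
have fm c : f (m c) = u *: c.
  have /(congr1 (fun h : {linear C -> C} => h c)) :=
    hK (f \o m : {linear C -> C}).
  by move=> /esym.
exists u => Z b [b_lin2 b_lin1] c c'; have [gP _ _] := A_res.
pose b1 z : {linear C -> Z} := mk_linear (b_lin1 z).
pose b2 z : {linear C -> Z} := mk_linear (b_lin2 z).
have bE1 z x : b x z = b1 z x by [].
have bE2 z x : b z x = b2 z x by [].
have b_comb z x d : comb g d = x -> b x z = \sum_l d 0 l *: b (g l) z.
  by move=> <-; rewrite bE1 comb_linear; apply: eq_bigr => l _; rewrite ffunE.
have [a ac] := gP c; have [a' ac'] := gP c'.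
pose v := [ffun l => a 0 l *: y c' - a' 0 l *: m c].
have [|w wP] := tensor_embedding (v := v).
  have -> : \sum_l i (v l) (g l) = i (y c') c - i (m c) c'.
    rewrite -{1}ac -{2}ac' (comb_linear (i (y c'))) (comb_linear (i (m c))).
    rewrite /= /comb_fun -sumrB.
    by apply: eq_bigr => l _; rewrite !ffunE linearB !linearZ.
  by rewrite mP subrr.
apply/eqP; rewrite -subr_eq0; apply/eqP.
have -> : s *: b c c' - u *: b c' c = \sum_l b (g l) (f (v l)).
  have -> : s *: b c c' = b c (f (y c')) by rewrite fy !bE2 linearZ.
  have -> : u *: b c' c = b c' (f (m c)) by rewrite fm !bE2 linearZ.
  rewrite (b_comb _ _ _ ac) (b_comb _ _ _ ac') -sumrB; apply: eq_bigr => l _.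
  by rewrite ffunE !bE2 [f (_ - _)]linearB [RHS]linearB !linearZ_LR.
transitivity (\sum_l \sum_j A 0%N j l *: b (g l) (f (w j))).
  apply: eq_bigr => l _; rewrite wP actE bE2 !linear_sum; apply: eq_bigr => j _.
  by rewrite !linearZ mxE.
rewrite exchange_big big1 // => j _.
have gA : \sum_l A 0%N j l *: g l = 0 by rewrite -actE resolution_act0 ffunE.
rewrite -[RHS](linear0 (b1 (f (w j)))) -gA linear_sum.
by apply: eq_bigr => l _; rewrite linearZ.
Qed.

End Embedding.

End FoxbyEquivalence.

(** * Local generators and the swap on the tensor square *)

Section LocalGenerators.
Variables (R : comPzRingType) (C : lmodType R) (p : set R).
Hypothesis p_prime : prime_ideal p.

Let p_ideal : is_ideal p. Proof. by case: p_prime. Qed.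

Lemma primeNM x y : ~ p x -> ~ p y -> ~ p (x * y).
Proof. by case: p_prime => _ _ pP nx ny /pP[]. Qed.

Lemma exists_ideal_quotient :
  exists (K : lmodType R) (q : {linear R^o -> K}),
    forall a : R, q a = 0 <-> p a.
Proof.
have [p0 pD pM] := p_ideal.
have [||W [i [_ iP]]] := @exists_submodule R R^o p.
- exact: p0.
- by move=> a x y px py; apply: pD => //; apply: pM.
have [K [q [_ qP]]] := exists_cokernel i.
by exists K, q => a; rewrite qP iP.
Qed.

Lemma reg_dist (e a x y z : R) :
  (a * x : R^o) - (e *: (a * y : R^o) + (a * z : R^o)) =
  a * (x - (e * y + z)).
Proof.
by change (a * x - (e * (a * y) + a * z) = a * (x - (e * y + z))); ring.
Qed.

(** The image of [h] generates the localization of [C] at [p], with a common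
    denominator [t]. *)
Definition local_generators n (h : {ffun 'I_n -> C}) (t : R) : Prop :=
  ~ p t /\ forall x, exists a, comb h a = t *: x.

(** A relation with a coefficient outside [p] would allow one of the generators
    to be dropped. *)
Lemma minimal_local_generators : fin_gen C ->
  exists n (h : {ffun 'I_n -> C}) t, local_generators h t /\
    forall a, comb h a = 0 -> forall i, p (a 0 i).
Proof.
move=> [n0 [g gP]]; have [_ p1 _] := p_prime.
pose P n := `[< exists (h : {ffun 'I_n -> C}) t, local_generators h t >].
have exP : exists n, P n.
  exists n0; apply/asboolP; exists [ffun k => g k], 1; split=> // x.
  have [a ->] := gP x; exists (\row_k a k); rewrite scale1r.
  by apply: eq_bigr => k _; rewrite mxE ffunE.
case: (ex_minnP exP) => n /asboolP[h [t [pt ht]]] n_min.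
exists n, h, t; split=> // a ha i; apply: contrapT => pai.
case: n => [|n] in h ht n_min a ha i pai *; first by case: i pai.
suff /n_min : P n by rewrite ltnn.
apply/asboolP; exists [ffun j => h (lift i j)], (a 0 i * t).
split=> [|x]; first exact: primeNM.
have [b hb] := ht x.
exists (\row_j (a 0 i * b 0 (lift i j) - b 0 i * a 0 (lift i j))).
have := hb; move: ha; rewrite /= /comb_fun !(bigD1_ord i) //= => ha hb'.
have hi : a 0 i *: h i = - \sum_j a 0 (lift i j) *: h (lift i j).
  by apply/eqP; rewrite -addr_eq0 ha.
rewrite -scalerA -hb' scalerDr scalerA mulrC -scalerA hi scalerN !scaler_sumr.
rewrite addrC -sumrB; apply: eq_bigr => j _.
by rewrite mxE ffunE scalerBl !scalerA.
Qed.

(** Modulo [p], the coordinates with respect to a minimal local system of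
    generators [h] are well defined linear functions. If [h] had more than one
    member, the product of the two coordinate functions would be a bilinear
    form taking the values [t ^+ 2] and [0] on two pairs of generators
    exchanged by the swap, so that [s * t ^+ 2] would belong to [p]. *)
Lemma swap_locally_cyclic (s u : R) : fin_gen C -> ~ p s ->
  (forall (Z : lmodType R) (b : C -> C -> Z), bilinear_map b ->
    forall c c', s *: b c c' = u *: b c' c) ->
  exists (c : C) (t : R), ~ p t /\ forall x, exists a, a *: c = t *: x.
Proof.
move=> /minimal_local_generators[n [h [t [[pt ht] h_min]]]] ps swap.
have [p0 pD pM] := p_ideal.
case: n => [|[|n]] in h ht h_min *.
- exists 0, t; split=> // x; exists 0; have [a <-] := ht x.
  by rewrite scale0r /= /comb_fun big_ord0.
- exists (h ord0), t; split=> // x; have [a <-] := ht x; exists (a 0 ord0).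
  by rewrite /= /comb_fun big_ord1.
have [K [q qP]] := exists_ideal_quotient.
have /choice[r rP] := ht.
have r_mod (i : 'I_n.+2) e x y :
  r (e *: x + y) 0 i - (e * r x 0 i + r y 0 i) \in p.
  have rel : comb h (r (e *: x + y) - (e *: r x + r y)) = 0.
    by rewrite linearB linearP !rP scalerDr !scalerA mulrC subrr.
  by rewrite inE; have := h_min _ rel i; rewrite !mxE.
have q_eq (x y : R) : x - y \in p -> q x = q y.
  by rewrite inE => /qP; rewrite linearB => /eqP; rewrite subr_eq0 => /eqP.
pose i0 : 'I_n.+2 := ord0; pose i1 : 'I_n.+2 := lift ord0 ord0.
pose b x y : K := q (r x 0 i0 * r y 0 i1 : R).
have b_bil : bilinear_map b.
  split=> [x e y z|y e x z]; rewrite /b -linearP; apply: q_eq; rewrite inE.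
    have := r_mod i1 e y z; rewrite inE => /(pM (r x 0 i0)).
    by rewrite -(reg_dist e (r x 0 i0)).
  have := r_mod i0 e x z; rewrite inE => /(pM (r y 0 i1)).
  by rewrite -(reg_dist e (r y 0 i1)) !(mulrC (r y 0 i1)).
have rh j l : r (h j) 0 l - (t *+ (l == j)) \in p.
  have rel : comb h (r (h j) - t *: delta_mx 0 j) = 0.
    by rewrite linearB linearZ_LR rP comb_delta subrr.
  by rewrite inE; have := h_min _ rel l; rewrite !mxE eqxx /= mulr_natr.
have := swap K b b_bil (h i0) (h i1).
have e1 : b (h i0) (h i1) = q (t * t : R).
  apply: q_eq; have := rh i0 i0; have := rh i1 i1; rewrite !eqxx !mulr1n !inE.
  move=> /(pM (r (h i0) 0 i0)) q1 /(pM t) q2; have := pD _ _ q1 q2.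
  by congr (p _); ring.
have e2 : b (h i1) (h i0) = q (0 : R).
  apply: q_eq; have := rh i1 i0; rewrite !mulr0n !inE !subr0.
  by move=> /(pM (r (h i0) 0 i1)); rewrite mulrC.
rewrite e1 e2 linear0 scaler0 -linearZ => /qP; rewrite [_ *: _]/(_ * _).
by move=> pst; case: (primeNM ps (primeNM pt pt)).
Qed.

(** If [C] has injective homothety map and is generated by [c] up to an element
    outside [p], then it is locally isomorphic to the ring: [a |-> a *: c] and
    [l] are inverse to each other up to [tau]. *)
Lemma locally_cyclic_unit (c : C) (t : R) : injective (homothety C) -> ~ p t ->
  (forall x, exists a, a *: c = t *: x) ->
  exists (l : {linear C -> R^o}) (tau : R),
    [/\ ~ p tau, l c = tau & forall x, (l x : R) *: c = tau *: x].
Proof.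
move=> C_inj pt /choice[a aP].
have ann b : b *: c = 0 -> t * b = 0.
  move=> bc; apply: C_inj; apply: linear_ext => x /=.
  by rewrite scale0r mulrC -scalerA -aP scalerA mulrC -scalerA bc scaler0.
have l_lin : linear (fun x => t * a x : R^o).
  move=> e x y; apply/eqP; rewrite -subr_eq0; apply/eqP.
  rewrite reg_dist; apply: ann; rewrite scalerBl scalerDl -scalerA !aP scalerDr.
  by rewrite !scalerA mulrC subrr.
exists (mk_linear l_lin), (t * t); split; first exact: primeNM.
  apply/eqP; rewrite mk_linearE -subr_eq0 -mulrBr; apply/eqP/ann.
  by rewrite scalerBl aP subrr.
by move=> x; rewrite mk_linearE -scalerA aP scalerA.
Qed.

End LocalGenerators.

(** * The support of a projective module *)

Section ProjectiveSupport.
Variables (R : comPzRingType) (p : set R).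
Hypothesis p_prime : prime_ideal p.

(** Nakayama's lemma at the prime [p] for a tuple of generators. *)
Lemma nakayama_local (V : lmodType R) n (x : {ffun 'I_n -> V}) (B : 'M[R]_n)
    (u : R) :
  ~ p u -> (forall i j, p (B i j)) -> u *: x = act V B x ->
  exists t, ~ p t /\ forall i, t *: x i = 0.
Proof.
have [[_ pD pM] p1 _] := p_prime.
elim: n x B u => [|n IHn] x B u pu pB ux.
  by exists 1; split=> // -[].
have uxE j : u *: x j =
    B j ord0 *: x ord0 + \sum_k B j (lift ord0 k) *: x (lift ord0 k).
  have /ffunP/(_ j) := ux; rewrite ffunE actE => ->.
  by rewrite big_ord_recl.
(* The first equation expresses [w *: x ord0] in terms of the other entries, and
   substituting it in the remaining equations eliminates [x ord0]. *)
pose w := u - B ord0 ord0.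
have pw : ~ p w.
  by move=> qw; apply: pu; rewrite -[u](subrK (B ord0 ord0)); apply: pD.
have wx : w *: x ord0 = \sum_k B ord0 (lift ord0 k) *: x (lift ord0 k).
  by rewrite scalerBl uxE addrC addKr.
pose B' := \matrix_(j, k)
  (w * B (lift ord0 j) (lift ord0 k) +
   B (lift ord0 j) ord0 * B ord0 (lift ord0 k)).
have [|j k||t [pt tx]] := IHn [ffun k => x (lift ord0 k)] B' (w * u).
- exact: primeNM.
- by rewrite mxE; apply: pD; apply: pM.
- apply/ffunP => j; rewrite actE !ffunE -scalerA uxE scalerDr scalerA mulrC.
  rewrite -scalerA wx !scaler_sumr -big_split; apply: eq_bigr => k _ /=.
  by rewrite mxE ffunE scalerDl !scalerA addrC.
exists (t * w); split=> [|i]; first exact: primeNM.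
have txl k : t *: x (lift ord0 k) = 0 by have := tx k; rewrite ffunE.
case: (unliftP ord0 i) => [k ->|->];
  first by rewrite mulrC -scalerA txl scaler0.
rewrite -scalerA wx scaler_sumr big1 // => k _.
by rewrite scalerA mulrC -scalerA txl scaler0.
Qed.

(** A dual basis of a projective module, indexed by its own elements. *)
Lemma projective_dual_basis (P : lmodType R) : projective P ->
  exists F : P -> {linear P -> R^o}, forall z, exists s : seq P,
    uniq s /\ z = \sum_(x <- s) (F x z : R) *: x.
Proof.
move=> P_proj; pose V : lmodType R := ((P -> R^o) * P)%type.
(* The graph of [f |-> \sum_x f x *: x] on the finitely supported functions:
   its second projection is onto, and is split by projectivity. *)
pose S (v : V) := exists s0 : seq P, forall s, uniq s -> {subset s0 <= s} ->
  v.2 = \sum_(x <- s) (v.1 x : R) *: x.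
have [||D [i [_ iP]]] := @exists_submodule R V S.
- by exists [::] => s _ _; rewrite big1 // => x _; rewrite scale0r.
- move=> a [f v] [g w] [s /= fs] [s' /= gs];
    exists (s ++ s') => r r_uniq ss'r /=.
  rewrite (fs r) // => [|x xs]; last by apply: ss'r; rewrite mem_cat xs.
  rewrite (gs r) // => [|x xs]; last by apply: ss'r; rewrite mem_cat xs orbT.
  rewrite scaler_sumr -big_split; apply: eq_bigr => x _ /=.
  by rewrite scalerDl scalerA.
have [z|h hP] := P_proj _ _ (snd \o i : {linear D -> P}) idfun.
  have /iP[d dz] : S ((fun x => (x == z)%:R), z).
    exists [:: z] => s s_uniq zs /=; have {}zs : z \in s by apply: zs;
      rewrite inE.
    rewrite (bigD1_seq z) //= eqxx scale1r big1 ?addr0 // => x xz.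
    by rewrite (negPf xz) scale0r.
  by exists d; rewrite /= dz.
have F_lin x : linear (fun z => (i (h z)).1 x : R^o).
  by move=> a y z; rewrite !linearP.
exists (fun x => mk_linear (F_lin x)) => z.
have [s sP] : S (i (h z)) by apply/iP; exists (h z).
exists (undup s); split; first exact: undup_uniq.
rewrite -[LHS](hP z) /= (sP (undup s)) ?undup_uniq // => x.
by rewrite mem_undup.
Qed.

(** A projective module whose linear forms all take their values in [p]
    vanishes at [p]: for a dual basis [F], the identity [F y z = \sum_(x <- s)
    F x z * F y x] makes Nakayama's lemma applicable to the finitely many
    coordinates of [z]. *)
Lemma projective_support (P : lmodType R) : projective P ->
  (forall (f : {linear P -> R^o}) y, p (f y)) ->
  forall z : P, exists t, ~ p t /\ t *: z = 0.
Proof.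
move=> /projective_dual_basis[F FP] fp z; have [s [_ zs]] := FP z.
have [_ p1 _] := p_prime.
pose x := [ffun k : 'I_(size s) => F (tnth (in_tuple s) k) z].
pose B : 'M[R]_(size s) :=
  \matrix_(j, i) F (tnth (in_tuple s) j) (tnth (in_tuple s) i).
have [i j||t [pt tx]] := nakayama_local (x := x) (B := B) p1.
- by rewrite mxE; apply: fp.
- rewrite scale1r; apply/ffunP => j;
    rewrite actE ffunE {1}zs big_tnth linear_sum.
  apply: eq_bigr => k _; rewrite linearZ_LR ffunE mxE; exact: mulrC.
exists t; split=> //; rewrite zs big_tnth scaler_sumr big1 // => k _.
by have := tx k; rewrite ffunE scalerA => tk; rewrite [t * _]tk scale0r.
Qed.

End ProjectiveSupport.

(** * Baer's criterion *)

Section Baer.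
Variables (A : comPzRingType) (E : lmodType A).

Hypothesis E_baer : forall (J : set A) (phi : A -> E), is_ideal J ->
  (forall a x y, J x -> J y -> phi (a * x + y) = a *: phi x + phi y) ->
  exists e, forall x, J x -> phi x = x *: e.

Section Extension.
Variables (U V : lmodType A) (i : {linear U -> V}) (f : {linear U -> E}).
Hypothesis i_inj : injective i.

(** Graphs of linear maps from submodules of [V] to [E] that extend [f] along
    [i]; the empty set is included as the union of the empty chain. *)
Definition partial_extension (G : set (V * E)) : Prop :=
  [/\ forall a x y, G x -> G y -> G (a *: x + y),
      forall e, G (0, e) -> e = 0
    & (exists x, G x) -> forall u, G (i u, f u)].

Lemma partial_extension_max : exists G : set (V * E),
  [/\ partial_extension G, forall u, G (i u, f u)
    & forall G', partial_extension G' -> G `<=` G' -> G' `<=` G].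
Proof.
have [F F_ext F_tot|G [G_ext G_max]] := @Zorn_bigcup _ partial_extension.
  split=> [a x y [X FX Xx] [Y FY Yy]|e [X FX Xe]|[x [X FX Xx]] u].
  - have [XY|YX] := F_tot X Y FX FY.
      by exists Y => //; have [lin _ _] := F_ext Y FY; apply: lin => //;
        apply: XY.
    by exists X => //; have [lin _ _] := F_ext X FX; apply: lin => //;
      apply: YX.
  - by have [_ fct _] := F_ext X FX; apply: fct.
  - by exists X => //; have [_ _ ext] := F_ext X FX; apply: ext; exists x.
have G_le G' : partial_extension G' -> G `<=` G' -> G' `<=` G.
  by move=> G'_ext GG'; apply: contrapT => nG'G; apply: (G_max G').
exists G; split=> //; have [_ _ ext] := G_ext; apply: ext.
apply: contrapT => G0;
  pose G1 : set (V * E) := fun x => exists u, x = (i u, f u).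
suff /(_ (fun x Gx => False_ind _ (G0 (ex_intro _ x Gx)))) G1G :
    G `<=` G1 -> G1 `<=` G.
  by apply: G0; exists (i 0, f 0); apply: G1G; exists 0.
apply: G_le; split=> [a x y [u ->] [v ->]|e [u [iu ->]]|_ u]; last by exists u.
- by exists (a *: u + v); rewrite (linearP i) (linearP f).
- have -> : u = 0 by apply: i_inj; rewrite -iu linear0.
  exact: linear0.
Qed.

Lemma baer_extension : exists h : {linear V -> E}, forall x, h (i x) = f x.
Proof.
have [G [[lin fct ext] G_f G_max]] := partial_extension_max.
have G_eq v e e' : G (v, e) -> G (v, e') -> e = e'.
  move=> Ge Ge'; apply/eqP; rewrite -subr_eq0; apply/eqP/fct.
  have := lin (- 1) _ _ Ge' Ge; congr (G _).
  by rewrite -[LHS]/(_, _) /= !scaleN1r addNr addrC.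
have G0 : G (0, 0) by have := G_f 0; rewrite !linear0.
have GZ a v e : G (v, e) -> G (a *: v, a *: e).
  by move=> /(lin a)/(_ G0); congr (G _); rewrite -[LHS]/(_, _) /= !addr0.
have GD v e w d : G (v, e) -> G (w, d) -> G (v + w, e + d).
  by move=> Gv Gw; have := lin 1 _ _ Gv Gw; congr (G _);
    rewrite -[LHS]/(_, _) /= !scale1r.
have G_dom v : exists e, G (v, e).
  pose J : set A := fun a => exists e, G (a *: v, e).
  have /choice[phi phiP] a : exists e, J a -> G (a *: v, e).
    have [[e Ge]|nJ] := pselect (J a); first by exists e.
    by exists 0 => /nJ.
  have [||e eP] := E_baer (J := J) (phi := phi).
  - split=> [|x y [e Ge] [d Gd]|a x [e Ge]].
    + by exists 0; rewrite scale0r.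
    + by exists (e + d); rewrite scalerDl; apply: GD.
    + by exists (a *: e); rewrite -scalerA; apply: GZ.
  - move=> a x y Jx Jy;
      have Gs := GD _ _ _ _ (GZ a _ _ (phiP _ Jx)) (phiP _ Jy).
    apply: (G_eq ((a * x + y) *: v)); last by rewrite scalerDl -scalerA.
    by apply: phiP; exists (a *: phi x + phi y); rewrite scalerDl -scalerA.
  pose G' : set (V * E) := fun z => exists w d a,
    G (w, d) /\ z = (w + a *: v, d + a *: e).
  exists e; apply: (G_max G'); last first.
  - by exists 0, 0, 1; rewrite !scale1r !add0r.
  - by move=> [w d] Gw; exists w, d, 0; rewrite !scale0r !addr0.
  split=> [a x y [w [d [b [Gw ->]]]] [w' [d' [b' [Gw' ->]]]]|d|_ u].
  - exists (a *: w + w'), (a *: d + d'), (a * b + b'); split.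
      by apply: GD => //; apply: GZ.
    by congr (_, _); rewrite /= scalerDr scalerDl addrACA scalerA.
  - move=> [w [d' [b [Gw [wv ->]]]]].
    have bv : b *: v = - 1 *: w.
      by rewrite scaleN1r; apply/eqP; rewrite -addr_eq0 addrC -wv.
    have Gb : G (b *: v, - 1 *: d') by rewrite bv; apply: GZ.
    have Jb : J b by exists (- 1 *: d').
    by rewrite -(eP b Jb) (G_eq _ _ _ (phiP b Jb) Gb) scaleN1r subrr.
  - by exists (i u), (f u), 0; rewrite !scale0r !addr0.
have /choice[h hP] := G_dom.
have h_lin : linear h.
  by move=> a x y; apply: G_eq (hP _) (lin _ _ _ (hP x) (hP y)).
by exists (mk_linear h_lin) => x; apply: G_eq (hP _) (G_f x).
Qed.

End Extension.

Lemma baer_injective : injective_module E.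
Proof. by move=> U V i f i_inj; apply: baer_extension. Qed.

End Baer.

(** * Localization at a prime *)

Section Localization.
Variables (R : comPzRingType) (p : Spec R).
Local Notation Rp := (local_ring p).
Local Notation "M '_p'" := (localization p M : lmodType Rp) (at level 2).
Implicit Types (M N U V W : lmodType R) (s t : denom p).

Let p_prime : prime_ideal (spec_ideal p) := specP p.

Definition mk_denom (a : R) (pa : ~ spec_ideal p a) : denom p :=
  Denom (asboolT pa).

Lemma fracD M (m n : M) s t : mk_frac m s + mk_frac n t =
  mk_frac (den_val t *: m + den_val s *: n) (denomM s t).
Proof. exact: loc_addE. Qed.

Lemma fracZ M (a : R) s (m : M) t :
  (mk_frac (a : R^o) s : Rp) *: (mk_frac m t : M _p) =
  mk_frac (a *: m) (denomM s t).
Proof. exact: loc_scaleE. Qed.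

Lemma fracM (a b : R) s t :
  (mk_frac (a : R^o) s : Rp) * (mk_frac (b : R^o) t : Rp) =
  mk_frac (a * b : R^o) (denomM s t).
Proof. exact: loc_mulE. Qed.

Lemma frac_eq0 M (m : M) s :
  mk_frac m s = 0 :> M _p <-> exists t, den_val t *: m = 0.
Proof.
rewrite -[0]/(mk_frac 0 (denom1 p)) mk_fracP; split=> [[u]|[u um]].
  by rewrite scaler0 mulr1 => um; exists u.
by exists u; rewrite scaler0 mulr1.
Qed.

Lemma frac_common_num M (m n : M) s :
  mk_frac m s + mk_frac n s = mk_frac (m + n) s.
Proof.
by rewrite fracD; apply: mk_frac_eq; rewrite /= -scalerDr scalerA.
Qed.

(** Conditions stable under multiples, each satisfied by some denominator, are
    simultaneously satisfied by some denominator if there are finitely many. *)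
Lemma denom_family k (Q : 'I_k -> denom p -> Prop) :
  (forall j, exists s, Q j s) ->
  (forall j s t, Q j s -> Q j (denomM t s)) -> exists s, forall j, Q j s.
Proof.
elim: k Q => [|k IHk] Q Qex QM; first by exists (denom1 p) => -[].
have [||s sP] := IHk (fun j => Q (lift ord0 j)).
- by move=> j.
- by move=> j; exact: QM.
have [t tP] := Qex ord0; exists (denomM s t) => j.
case: (unliftP ord0 j) => [i ->|->]; last exact: QM.
have -> : denomM s t = denomM t s by apply: val_inj; rewrite /= mulrC.
exact: QM.
Qed.

Lemma common_denom M k (x : 'I_k -> localization p M) :
  exists (m : 'I_k -> M) s, forall j, x j = mk_frac (m j) s.
Proof.
have [|j s t [m ->]|s sP] :=
  @denom_family k (fun j s => exists m, x j = mk_frac m s).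
- by move=> j; elim/loc_ind: (x j) => m s; exists s, m.
- by exists (den_val t *: m); apply: mk_frac_eq; rewrite /= scalerA mulrC.
by have /choice[m mP] := sP; exists m, s.
Qed.

Section Map.
Variables (U V : lmodType R) (f : {linear U -> V}).

(** The map induced by [f] on localizations. *)
Definition loc_fun (x : localization p U) : localization p V :=
  mk_frac (f (numer x)) (denominator x).

Lemma loc_funE m s : loc_fun (mk_frac m s) = mk_frac (f m) s.
Proof.
have [u eu] := (mk_fracP _ _ _ _).1 (mk_fracK (mk_frac m s)).
by apply/mk_fracP; exists u; rewrite -!linearZ eu.
Qed.

Fact loc_fun_linear : linear (loc_fun : U _p -> V _p).
Proof.
elim/loc_ind => a s; elim/loc_ind => m t; elim/loc_ind => n u.
by rewrite fracZ fracD !loc_funE fracZ fracD (linearD f) !(linearZ_LR f).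
Qed.

Definition loc_map : {linear U _p -> V _p} := mk_linear loc_fun_linear.

Lemma loc_mapE m s : loc_map (mk_frac m s) = mk_frac (f m) s.
Proof. exact: loc_funE. Qed.

End Map.

Lemma loc_short_exact U V W (i : {linear U -> V}) (q : {linear V -> W}) :
  short_exact i q -> short_exact (loc_map i) (loc_map q).
Proof.
move=> [i_inj q_surj qP]; split.
- apply: linear_inj0; elim/loc_ind => m s; rewrite loc_mapE => /frac_eq0[t tm].
  by apply/frac_eq0; exists t; apply: i_inj; rewrite linearZ_LR tm linear0.
- elim/loc_ind => w s; have [v <-] := q_surj w.
  by exists (mk_frac v s); rewrite loc_mapE.
elim/loc_ind => v s; rewrite loc_mapE; split=> [/frac_eq0[t]|[]].
  rewrite -linearZ_LR => /qP[u iu]; exists (mk_frac u (denomM t s)).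
  by rewrite loc_mapE iu; apply: mk_frac_eq; rewrite /= scalerA mulrC.
elim/loc_ind => u t; rewrite loc_mapE => /mk_fracP[w].
rewrite -!linearZ_LR => e; apply/frac_eq0; exists (denomM w t).
by rewrite -linearZ_LR /= -e; apply/qP; exists ((den_val w * den_val s) *: u).
Qed.

Lemma loc_is_zero M : is_zero M -> is_zero (M _p).
Proof.
by move=> M0; elim/loc_ind => m s; apply/frac_eq0; exists s;
  rewrite (M0 m) scaler0.
Qed.

(** A linear map with a left inverse up to an element outside [p] becomes the
    inclusion of a retract on localizations. *)
Lemma loc_retract U V (f : {linear U -> V}) (g : {linear V -> U}) (a : R) :
  ~ spec_ideal p a -> (forall x, g (f x) = a *: x) ->
  exists g' : {linear V _p -> U _p}, cancel (loc_map f) g'.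
Proof.
move=> pa gf; pose b : Rp := mk_frac (1 : R^o) (mk_denom pa).
have bg_lin : linear (fun x => b *: loc_map g x).
  move=> c x y; rewrite linearP scalerDr !scalerA.
  by rewrite [b * c]mulrC.
exists (mk_linear bg_lin); elim/loc_ind => m s.
rewrite mk_linearE !loc_mapE fracZ gf; apply: mk_frac_eq => /=.
by rewrite !scalerA; congr (_ *: _); ring.
Qed.

(** * The ring R_p *)

(** The fractions [a / 1] and [1 / s]. *)
Definition loc_elt (a : R) : Rp := mk_frac (a : R^o) (denom1 p).
Definition loc_inv s : Rp := mk_frac (1 : R^o) s.

Lemma frac_loc_elt (a : R) s :
  mk_frac (a : R^o) s = loc_inv s * loc_elt a :> Rp.
Proof. by rewrite fracM; apply: mk_frac_eq; rewrite mul1r /= mulr1. Qed.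

Lemma loc_inv_elt s : loc_inv s * loc_elt (den_val s) = 1.
Proof.
rewrite fracM -[RHS]/(mk_frac (1 : R^o) (denom1 p)); apply: mk_frac_eq => /=.
by change (1 * (1 * den_val s) = den_val s * 1 * 1); rewrite !mul1r !mulr1.
Qed.

Lemma loc_eltD a b : loc_elt (a + b) = loc_elt a + loc_elt b.
Proof. by rewrite /loc_elt [RHS]frac_common_num. Qed.

Lemma loc_eltM a b : loc_elt (a * b) = loc_elt a * loc_elt b.
Proof. by rewrite fracM; apply: mk_frac_eq; rewrite /= mulr1. Qed.

Lemma loc_elt0 : loc_elt 0 = 0. Proof. by []. Qed.

Lemma loc_elt_sum k (F : 'I_k -> R) :
  loc_elt (\sum_j F j) = \sum_j loc_elt (F j).
Proof. by apply: big_morph => //; exact: loc_eltD. Qed.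

(** Ideals of [R_p] are generated by finitely many elements of [R]. *)
Lemma loc_ideal_generators (J : set Rp) : noetherian R -> is_ideal J ->
  exists k (a : 'I_k -> R), forall x,
    J x <-> exists c : 'I_k -> Rp, x = \sum_j c j * loc_elt (a j).
Proof.
move=> R_noeth [J0 JD JM].
pose I : set R := fun a => J (loc_elt a).
have I_ideal : is_ideal I.
  split=> [|x y|a x]; rewrite /I.
  - by rewrite loc_elt0.
  - by rewrite loc_eltD; exact: JD.
  - by rewrite loc_eltM; exact: JM.
have [k [a aP]] := R_noeth I I_ideal; exists k, a => x; split; last first.
  move=> [c ->]; elim/big_ind: _ => // j _; apply: JM.
  rewrite -[J _]/(I (a j)) aP; exists (fun i => (i == j)%:R).
  rewrite (bigD1 j) //= eqxx mul1r big1 ?addr0 // => i ij.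
  by rewrite (negPf ij) mul0r.
elim/loc_ind: x => b s Jb.
have Ib : I b.
  have := JM (loc_elt (den_val s)) _ Jb.
  by rewrite frac_loc_elt mulrA [loc_elt _ * _]mulrC loc_inv_elt mul1r.
move: Ib; rewrite aP => -[c bE]; exists (fun j => loc_inv s * loc_elt (c j)).
rewrite frac_loc_elt bE loc_elt_sum mulr_sumr; apply: eq_bigr => j _.
by rewrite loc_eltM mulrA.
Qed.

Lemma loc_noetherian : noetherian R -> noetherian Rp.
Proof.
move=> R_noeth J J_ideal;
  have [k [a aP]] := loc_ideal_generators R_noeth J_ideal.
exists k, (fun j => loc_elt (a j)); apply/seteqP; split=> x; first by move/aP.
by move=> xP; apply/aP.
Qed.

(** The maximal ideal [p R_p]. *)
Definition loc_max : set Rp :=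
  [set x | exists a s, spec_ideal p a /\ x = mk_frac (a : R^o) s].

Lemma loc_max_ideal : is_ideal loc_max.
Proof.
have [[p0 pD pM] _ _] := p_prime; split=> [|x y|].
- by exists 0, (denom1 p).
- move=> [a [s [pa ->]]] [b [t [pb ->]]].
  exists (den_val t * a + den_val s * b), (denomM s t); split;
    last exact: fracD.
  by apply: pD; apply: pM.
- elim/loc_ind => a s _ [b [t [pb ->]]]; exists (a * b), (denomM s t).
  by split; [exact: pM | exact: fracM].
Qed.

Lemma loc_max1 : ~ loc_max 1.
Proof.
move=> [a [s [pa e]]].
have /mk_fracP[u us] : mk_frac (1 : R^o) (denom1 p) = mk_frac (a : R^o) s := e.
have [[p0 pD pM] _ _] := p_prime.
have {}us : den_val u * den_val s = den_val u * a.
  by have : den_val u * den_val s * 1 = den_val u * 1 * a := us; rewrite !mulr1.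
apply: (asboolW (denP (denomM u s))); rewrite /= us.
exact: pM.
Qed.

Lemma loc_proper_ideal (J : set Rp) : is_ideal J -> ~ J 1 -> J `<=` loc_max.
Proof.
move=> [J0 JD JM] J1; elim/loc_ind => a s Jx; exists a, s; split=> //.
apply: contrapT => pa; apply: J1.
have -> : 1 =
    (loc_elt (den_val s) * loc_inv (mk_denom pa)) * mk_frac (a : R^o) s :> Rp.
  rewrite -[LHS](mulr1 1) -{1}(loc_inv_elt s) -(loc_inv_elt (mk_denom pa))
    frac_loc_elt.
  by rewrite /=; ring.
exact: JM.
Qed.

Lemma loc_is_local : is_local Rp.
Proof.
exists loc_max; split=> [|m [m_ideal m1 m_max]].
  split=> [||J J_ideal J1 mJ]; [exact: loc_max_ideal | exact: loc_max1 |].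
  by apply/seteqP; split=> //; exact: loc_proper_ideal.
exact: m_max loc_max_ideal loc_max1 (loc_proper_ideal m_ideal m1).
Qed.

(** * Injective modules over R_p *)

(** By Baer's criterion: a linear map from a finitely generated ideal of [R_p]
    to [I_p] is a fraction of a linear map from an ideal of [R] to [I]. The
    factor [u] kills the finitely many obstructions to the existence of the
    latter. *)
Lemma loc_injective (I : lmodType R) : noetherian R -> injective_module I ->
  injective_module (I _p).
Proof.
move=> R_noeth I_inj; apply: baer_injective => J phi J_ideal phi_lin.
have [k [a aP]] := loc_ideal_generators R_noeth J_ideal.
have [J0 JD JM] := J_ideal.
have Ja j : J (loc_elt (a j)).
  apply/aP; exists (fun i => (i == j)%:R).
  rewrite (bigD1 j) //= eqxx mul1r big1 ?addr0 // => i ij.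
  by rewrite (negPf ij) mul0r.
have phi0 : phi 0 = 0.
  have := phi_lin 1 0 0 J0 J0; rewrite mulr0 addr0 scale1r => /esym/eqP.
  by rewrite -subr_eq0 addrK => /eqP.
have phi_sum (c : 'I_k -> Rp) :
    J (\sum_j c j * loc_elt (a j)) /\
    phi (\sum_j c j * loc_elt (a j)) = \sum_j c j *: phi (loc_elt (a j)).
  elim/big_rec2: _ => [//|j y x _ [Jx phix]].
  split; first by apply: JD => //; apply: JM.
  by rewrite phi_lin // phix.
have [z [t zP]] := common_denom (fun j => phi (loc_elt (a j))).
pose az : {linear 'rV[R]_k -> R^o} := comb [ffun j => a j : R^o].
have [m [B BP]] := noetherian_syzygy R_noeth az.
have [|j s s' Bs|u uB] :=
  @denom_family m (fun j s => den_val s *: \sum_l B j l *: z l = 0).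
- move=> j; apply/(@frac_eq0 I _ t).
  have Bj : \sum_l B j l * a l = 0 :> R.
    have /BP : exists b, row j B = b *m B.
      by exists (delta_mx 0 j); rewrite rowE.
    move=> Bj; rewrite -[RHS]Bj; apply: eq_bigr => l _.
    by rewrite mxE ffunE.
  have [_ phiB] := phi_sum (fun l => loc_elt (B j l)).
  transitivity (\sum_l loc_elt (B j l) *: phi (loc_elt (a l))).
    have fsum :
        {morph (fun y : I => mk_frac y t : I _p) : x y / x + y >-> x + y}.
      by move=> x y; rewrite frac_common_num.
    rewrite (big_morph _ fsum (id1 := 0)); last first.
      by apply/frac_eq0; exists t; rewrite scaler0.
    by apply: eq_bigr => l _; rewrite zP fracZ; apply: mk_frac_eq;
      rewrite /= mul1r.
  rewrite -phiB -phi0; congr phi; rewrite -[RHS]loc_elt0 -Bj loc_elt_sum.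
  by apply: eq_bigr => l _; rewrite loc_eltM.
- by rewrite /= -scalerA Bs scaler0.
have [r|h hP] := injective_factor (b := az)
  (f := comb [ffun j => den_val u *: z j]) I_inj.
  move=> /BP[b ->]; rewrite comb_mulmx (_ : act I B _ = 0) ?comb0 //.
  apply/ffunP => j; rewrite actE [RHS]ffunE -[RHS](uB j) scaler_sumr.
  by apply: eq_bigr => l _; rewrite ffunE !scalerA mulrC.
have uz j : den_val u *: z j = a j *: h (1 : R^o).
  have := hP (delta_mx 0 j); rewrite !comb_delta !ffunE => <-.
  by rewrite -linearZ_LR; congr (h _); exact: esym (mulr1 (a j)).
exists (mk_frac (h (1 : R^o)) (denomM u t)) => x /aP[c ->].
have [_ ->] := phi_sum c; rewrite scaler_suml; apply: eq_bigr => j _.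
rewrite -scalerA; congr (_ *: _); rewrite zP fracZ; apply: mk_frac_eq => /=.
by rewrite -uz !scalerA; congr (_ *: _); ring.
Qed.

End Localization.

(** * Gorenstein localizations *)

Section LocalCoresolution.
Variables (R : comPzRingType) (C : lmodType R) (p : Spec R).
Variables (c : C) (l : {linear C -> R^o}) (tau : R).
Hypotheses (p_tau : ~ spec_ideal p tau) (R_noeth : noetherian R).
Hypothesis lc : forall x, (l x : R) *: c = tau *: x.

(** By [lc], evaluation at [c] makes [Hom(C, I)_p] a retract of [I_p]. *)
Lemma class_IC_loc_injective (X : lmodType R) : class_IC C X ->
  injective_module (localization p X : lmodType (local_ring p)).
Proof.
move=> [I I_inj [f /bijective_linearV[h fK hK]]].
have F_lin : linear (fun x => f x c) by move=> a x y; rewrite linearP.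
have lz_lin (z : I) : linear (fun x => (l x : R) *: z).
  by move=> a x y; rewrite linearP scalerDl -scalerA.
have G_lin : linear (fun z => h (mk_linear (lz_lin z))).
  move=> a x y; rewrite -linearP; congr (h _); apply: linear_ext => w /=.
  by rewrite scalerDr !scalerA mulrC.
have [x|g' gK] := @loc_retract R p X I (mk_linear F_lin) (mk_linear G_lin) tau
  p_tau.
  rewrite !mk_linearE -[RHS]fK linearZ_LR; congr (h _);
    apply: linear_ext => w /=.
  by rewrite -(linearZ_LR (f x)) lc (linearZ_LR (f x)).
exact: injective_retract gK (loc_injective R_noeth I_inj).
Qed.

Lemma finite_coresolution_loc k (N : lmodType R) :
  finite_coresolution (class_IC C) k N ->
  finite_coresolution (@injective_module (local_ring p)) k
    (localization p N : lmodType (local_ring p)).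
Proof.
elim: k N => [|k IHk] N /=; first exact: loc_is_zero.
move=> [X [Q [i [q [XX iq Qk]]]]].
exists (localization p X : lmodType (local_ring p)),
  (localization p Q : lmodType (local_ring p)), (loc_map p i), (loc_map p q).
by split; [exact: class_IC_loc_injective | exact: loc_short_exact | exact: IHk].
Qed.

End LocalCoresolution.

Section Tensors.
Variables (R : comPzRingType) (P C : lmodType R).

Lemma tensor_ind (S : tensor P C -> Prop) : S 0 ->
  (forall x c u, S u -> S (pure_tensor x c + u)) -> forall u, S u.
Proof.
move=> S0 SD u; rewrite -[u]tensor_reprK;
  elim: (tensor_repr u) => [|[x c] s IHs].
  exact: S0.
suff -> : tensor_pi ((x, c) :: s) = pure_tensor x c + tensor_pi s by exact: SD.
apply/tensor_eqP => Z b hb; rewrite sum_eval_cat !sum_eval_repr //.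
by rewrite /sum_eval big_cons big_seq1.
Qed.

(** If [P] vanishes at [p], so does its tensor product with [C]. *)
Lemma tensor_torsion (p : Spec R) :
  (forall x : P, exists t, ~ spec_ideal p t /\ t *: x = 0) ->
  is_zero (localization p (tensor P C : lmodType R)).
Proof.
move=> P0; elim/loc_ind => u s; apply/frac_eq0.
suff [t [pt tu]] : exists t, ~ spec_ideal p t /\ t *: u = 0.
  by exists (mk_denom pt).
elim/tensor_ind: u => [|x c u [t [pt tu]]].
  by exists 1; rewrite scaler0; split=> //; case: (specP p).
have [t' [pt' tx]] := P0 x; exists (t' * t); split.
  exact: (primeNM (specP p)).
have [_ b_lin] := @pure_tensor_bilinear R P C.
rewrite scalerDr -[X in _ + X]scalerA tu scaler0 addr0 mulrC -scalerA.
by rewrite -[t' *: _](linearZ_LR (mk_linear (b_lin c))) tx linear0 scaler0.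
Qed.

End Tensors.

Theorem theorem2 (R : comPzRingType) (C M : lmodType R) :
  noetherian R -> semidualizing C ->
  PC_pd C M = 0%E -> (IC_id C M < +oo)%E ->
  forall p : Spec R, Supp M p -> gorenstein_local (local_ring p).
Proof.
move=> R_noeth C_sd /proj_dim0[M_n0 [X [P P_proj XP] XM]].
move=> /(inj_dim_fin M_n0)[k M_cores] p pM.
split; [exact: loc_noetherian | exact: loc_is_local |].
have [phi /bijective_linearV[psi phiK psiK]] :=
  isomorphic_trans (isomorphic_sym XM) XP.
have p_prime := specP p.
have [f0 [y0 ps]] : exists (f : {linear P -> R^o}) y, ~ spec_ideal p (f y).
  apply: contrapT => nf; apply: pM; elim/loc_ind => m s.
  have P0 : forall z : P, exists t, ~ spec_ideal p t /\ t *: z = 0.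
    apply: projective_support => // f y; apply: contrapT => fy.
    by apply: nf; exists f, y.
  have /frac_eq0[t tm] := tensor_torsion (C := C) P0 (mk_frac (phi m) s).
  apply/frac_eq0; exists t; apply: (can_inj phiK).
  by rewrite linearZ_LR tm linear0.
set s : R := f0 y0 in ps.
have [pure_lin _] := @pure_tensor_bilinear R P C.
pose y : {linear C -> M} := psi \o mk_linear (pure_lin y0).
have map_tensor (Z : lmodType R) (e : {linear C -> Z}) :
    exists h : {linear M -> Z}, forall c, h (y c) = s *: e c.
  have b_bil : bilinear_map (fun x c => (f0 x : R) *: e c).
    split=> [x a c d|c a x x'];
      first by rewrite linearP scalerDr !scalerA mulrC.
    by rewrite linearP scalerDl scalerA.
  have [h [hP _]] := tensor_univ b_bil.
  by exists (h \o phi : {linear M -> Z}) => c; rewrite /= psiK hP.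
have [f fy] := map_tensor C idfun.
(* [s = f0 y0] lies outside [p], and the multiplication by [s] on [C] is the
   composition of [c |-> y0 (x) c] and [x (x) c |-> f0 x *: c]. *)
have [C_fg C_hom _] := C_sd.
have [n [A [g A_res]]] := free_resolution_exists R_noeth C_fg.
case: k => [|k] in M_cores *; first by case: M_n0.
have [I [Q [i [q [I_inj iq Q_cores]]]]] := finite_coresolution_hom M_cores.
have [u swap] := tensor_swap A_res C_sd I_inj iq Q_cores fy.
have [c [t [pt tc]]] := swap_locally_cyclic p_prime C_fg ps swap.
have [l [tau [p_tau lc lx]]] :=
  locally_cyclic_unit p_prime (bij_inj C_hom) pt tc.
(* The localization of [M] has finite injective dimension, and [R_p] is a
   retract of it by means of [a |-> a *: y c] and [b]. *)
have M_loc := inj_dim_leW (finite_coresolution_loc p_tau R_noeth lx M_cores).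
have [b bP] := map_tensor R^o l.
have a_lin : linear (fun a : R^o => (a : R) *: y c).
  by move=> e a a'; rewrite scalerDl scalerA.
have [a|r rK] := @loc_retract R p R^o M (mk_linear a_lin) b (s * tau)
  (primeNM p_prime ps p_tau).
  by rewrite mk_linearE linearZ_LR bP lc; apply: mulrC.
have Rp_dim := inj_dim_le_retract rK M_loc.
(* [R_p] as a module over itself and as a localization of the module [R] have
   the same underlying operations, but are different structures. *)
have id1 : linear (id : (local_ring p)^o -> localization p R^o) by [].
have id2 : linear (id : localization p R^o -> (local_ring p)^o) by [].
apply: (@inj_dim_lty _ k.+1).
exact: (inj_dim_le_retract (i := mk_linear id1) (r := mk_linear id2) _ Rp_dim).
Qed.
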